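(* Let $d\ge 1$ and let $\{M_k\}_{k\ge1}$, $\{N_k\}_{k\ge1}$ be sequences of integers with $M_k\ge 2$ and $1\le N_k\le M_k^d$ for all $k$. Let $\Omega=\Omega(M_k,N_k)$ be the associated compact metric space of Cantor sets $E\subset[0,1]^d$ with the Hausdorff metric, and let $t^*, s_2$ be the numbers defined in the context. Then: (1) For a typical $E\in\Omega$, $\dim_H E=\underline{\dim}_B E=t^{*}$. (2) For a typical $E\in\Omega$, $\dim_P E=\overline{\dim}_B E=s_2$. (3) If $\{N_k\}$ is unbounded, then for a typical $E\in\Omega$, $\dim_A E=d$.
   Context: Notation: $P_n=\prod_{i=1}^n N_i$, $r_n=\big(\prod_{i=1}^n M_i\big)^{-1}$. $\mathcal{D}_n$ is the family of closed cubes $\prod_{\ell=1}^d[i_\ell r_n,(i_\ell+1)r_n]$ with integers $0\le i_\ell\le r_n^{-1}-1$. The space $\Omega$: it consists of all sets $E=\bigcap_{n\ge1}E_n$ where $E_1$ is a union of $N_1$ distinct cubes of $\mathcal{D}_1$ and, for each $n$, $E_{n+1}$ is obtained by choosing, inside each of the $P_n$ chosen cubes of $E_n$, exactly $N_{n+1}$ distinct cubes among the $M_{n+1}^d$ subcubes belonging to $\mathcal{D}_{n+1}$, and taking the union of all chosen cubes. $\Omega$ is a closed subset of the compact space $\mathcal{K}([0,1]^d)$ of compact subsets of $[0,1]^d$ with the Hausdorff metric $d_H$; hence $(\Omega,d_H)$ is a compact metric space. Typical: a typical $E\in\Omega$ has a property if the set of $E\in\Omega$ not having it is of first category in $(\Omega,d_H)$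 (a countable union of nowhere dense sets). Numbers: $$t^*=\liminf_{n\to\infty}\frac{\log P_n}{-\log r_{n+1}-\frac1d\log N_{n+1}},\qquad s_2=\limsup_{n\to\infty}\frac{\log P_{n+1}}{-\log r_n+\frac1d\log N_{n+1}}.$$ $\dim_H,\dim_P,\underline{\dim}_B,\overline{\dim}_B$ are the usual Hausdorff, packing, lower box and upper box dimensions. $\mathcal{N}(F,\delta)$ is the smallest number of sets of diameter at most $\delta$ which can cover $F$. The Assouad dimension $\dim_A E$ is the infimum of $s\ge0$ for which there is $C>0$ such that for all $0<r<R\le\sqrt d$, $\sup_{x\in E}\mathcal{N}(E\cap B(x,R),r)\le C(R/r)^s$. *)

(* Defs.v *)
From HB Require Import structures.
From mathcomp Require Import all_boot all_order all_algebra.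
From mathcomp Require Import all_classical all_reals all_analysis.
From mathcomp Require Import ring lra.

Set Implicit Arguments.
Unset Strict Implicit.
Unset Printing Implicit Defensive.

Import Order.TTheory GRing.Theory Num.Theory.
Import numFieldNormedType.Exports.

Local Open Scope classical_set_scope.
Local Open Scope card_scope.
Local Open Scope ring_scope.

(* The library norm on row vectors is the sup norm, hence an explicit
   Euclidean distance. *)
Section euclidean.
Context {R : realType} {d : nat}.
Implicit Types (x y z : 'rV[R]_d) (A B : set 'rV[R]_d) (r : R).

Definition eudist x y : R := Num.sqrt (\sum_(l < d) (x 0 l - y 0 l) ^+ 2).

Definition cball x r : set 'rV[R]_d := [set y | eudist x y <= r].

(* The added 0 only matters for the empty set, whose diameter is 0. *)
Definition ediam A : \bar R :=
  ereal_sup (0%E |` [set z | exists x y, [/\ A x, A y & z = (eudist x y)%:E]]).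

Definition hausdorff_dist A B : \bar R :=
  ereal_inf [set e%:E | e in [set e | [/\ 0 <= e,
    (forall a, A a -> exists2 b, B b & eudist a b <= e) &
    (forall b, B b -> exists2 a, A a & eudist a b <= e)]]].

Lemma eudist_ge0 x y : 0 <= eudist x y.
Proof. exact: sqrtr_ge0. Qed.

Lemma eudistxx x : eudist x x = 0.
Proof.
by rewrite /eudist big1 ?sqrtr0// => l _; rewrite subrr expr0n.
Qed.

Lemma eudist_sym x y : eudist x y = eudist y x.
Proof. by congr Num.sqrt; apply: eq_bigr => l _; rewrite -sqrrN opprB. Qed.

Lemma sum_cauchy_schwarz (n : nat) (a b : 'I_n -> R) :
  (\sum_(i < n) a i * b i) ^+ 2 <=
  (\sum_(i < n) a i ^+ 2) * (\sum_(i < n) b i ^+ 2).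
Proof.
rewrite -subr_ge0.
have -> : (\sum_(i < n) a i ^+ 2) * (\sum_(i < n) b i ^+ 2) -
    (\sum_(i < n) a i * b i) ^+ 2 =
    2^-1 * \sum_(i < n) \sum_(j < n) (a i * b j - a j * b i) ^+ 2.
  have mulE (f g : 'I_n -> R) : (\sum_i f i) * (\sum_j g j) =
      \sum_i \sum_j f i * g j.
    by rewrite mulr_suml; apply: eq_bigr => i _; rewrite mulr_sumr.
  have -> : \sum_(i < n) \sum_(j < n) (a i * b j - a j * b i) ^+ 2 =
    \sum_(i < n) \sum_(j < n) a i ^+ 2 * b j ^+ 2 +
    \sum_(i < n) \sum_(j < n) b i ^+ 2 * a j ^+ 2 -
    2 * \sum_(i < n) \sum_(j < n) (a i * b i) * (a j * b j).
    rewrite mulr_sumr -big_split/= -sumrB; apply: eq_bigr => i _.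
    rewrite mulr_sumr -big_split/= -sumrB; apply: eq_bigr => j _.
    by ring.
  rewrite -!mulE expr2.
  by field.
apply: mulr_ge0; first by rewrite invr_ge0.
by apply: sumr_ge0 => i _; apply: sumr_ge0 => j _; exact: sqr_ge0.
Qed.

Lemma eudist_triangle x y z : eudist x z <= eudist x y + eudist y z.
Proof.
rewrite -(@ler_pXn2r _ 2) ?nnegrE ?eudist_ge0 ?addr_ge0 ?eudist_ge0//.
have S0 (u v : 'rV[R]_d) : 0 <= \sum_(l < d) (u 0 l - v 0 l) ^+ 2.
  by apply: sumr_ge0 => l _; exact: sqr_ge0.
rewrite sqrrD /eudist !sqr_sqrtr//.
set a := fun l : 'I_d => x 0 l - y 0 l; set b := fun l : 'I_d => y 0 l - z 0 l.
have -> : \sum_(l < d) (x 0 l - z 0 l) ^+ 2 =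
    \sum_(l < d) a l ^+ 2 + (\sum_(l < d) a l * b l) *+ 2 +
    \sum_(l < d) b l ^+ 2.
  rewrite -sumrMnl -!big_split/=; apply: eq_bigr => l _.
  by rewrite /a /b; ring.
rewrite lerD2r lerD2l lerMn2r/= -sqrtrM//.
apply: le_trans (ler_norm _) _.
by rewrite -sqrtr_sqr ler_sqrt ?mulr_ge0// sum_cauchy_schwarz.
Qed.

Lemma hausdorff_distxx A : (hausdorff_dist A A <= 0)%E.
Proof.
apply: ereal_inf_lbound; exists 0 => //; split => // a Aa;
  by exists a; rewrite // eudistxx.
Qed.

Lemma hausdorff_dist_sym A B : hausdorff_dist A B = hausdorff_dist B A.
Proof.
congr ereal_inf; congr image; apply/seteqP; split => e [e0 AB BA]; split => //.
- by move=> b /BA[a Aa ?]; exists a; rewrite // eudist_sym.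
- by move=> a /AB[b Bb ?]; exists b; rewrite // eudist_sym.
- by move=> b /BA[a Aa ?]; exists a; rewrite // eudist_sym.
- by move=> a /AB[b Bb ?]; exists b; rewrite // eudist_sym.
Qed.

Lemma hausdorff_dist_triangle A B C (e1 e2 : R) :
  (hausdorff_dist A B < e1%:E -> hausdorff_dist B C < e2%:E ->
   hausdorff_dist A C < (e1 + e2)%:E)%E.
Proof.
move=> /ereal_inf_lt[_ [e [e0 AB BA] <-]] ee1.
move=> /ereal_inf_lt[_ [f [f0 BC CB] <-]] fe2.
rewrite !lte_fin in ee1 fe2.
apply: (@le_lt_trans _ _ (e + f)%:E); last by rewrite lte_fin ltrD.
apply: ereal_inf_lbound; exists (e + f) => //; split.
- exact: addr_ge0.
- move=> a /AB[b /BC[c Cc bc] ab]; exists c => //.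
  by apply: le_trans (eudist_triangle _ b _) _; exact: lerD.
- move=> c /CB[b /BA[a Aa ab] bc]; exists a => //.
  by apply: le_trans (eudist_triangle _ b _) _; exact: lerD.
Qed.

End euclidean.

Section dimensions.
Context {R : realType} {d : nat}.
Implicit Types (E F : set 'rV[R]_d) (s : R).

Definition hausdorff_premeasure s (delta : R) E : \bar R :=
  ereal_inf [set z | exists (I : set nat) (U : nat -> set 'rV[R]_d),
    [/\ (forall i, I i -> ediam (U i) <= delta%:E)%E,
        E `<=` \bigcup_(i in I) U i &
        z = \esum_(i in I) (ediam (U i) `^ s)%E]].

Definition hausdorff_measure s E : \bar R :=
  ereal_sup [set hausdorff_premeasure s delta E | delta in [set e | 0 < e]].

Definition dimH E : \bar R :=
  ereal_inf [set s%:E | s in [set s | 0 <= s /\ hausdorff_measure s E = 0%E]].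

(* Supremum over countable families of pairwise disjoint closed balls centred
   in E; for 0 < d the diameter of a ball of radius rho is 2 * rho. *)
Definition packing_premeasure_at s (delta : R) E : \bar R :=
  ereal_sup [set z | exists (I : set nat) (c : nat -> 'rV[R]_d)
      (rho : nat -> R),
    [/\ (forall i, I i -> E (c i)),
        (forall i, I i -> 0 < rho i <= delta),
        trivIset I (fun i => cball (c i) (rho i)) &
        z = \esum_(i in I) ((2 * rho i) `^ s)%:E]].

Definition packing_premeasure s E : \bar R :=
  ereal_inf [set packing_premeasure_at s delta E | delta in [set e | 0 < e]].

(* The premeasure is not countably subadditive, hence the second infimum. *)
Definition packing_measure s E : \bar R :=
  ereal_inf [set (\sum_(0 <= i <oo) packing_premeasure s (F i))%E |
    F in [set F : nat -> set 'rV[R]_d | E `<=` \bigcup_i F i]].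

Definition dimP E : \bar R :=
  ereal_inf [set s%:E | s in [set s | 0 <= s /\ packing_measure s E = 0%E]].

(* It is +oo when F has no finite cover by sets of diameter at most delta. *)
Definition covering_number F (delta : R) : \bar R :=
  ereal_inf [set n%:R%:E | n in [set n : nat |
    exists U : 'I_n -> set 'rV[R]_d,
      (forall i, ediam (U i) <= delta%:E)%E /\ F `<=` \bigcup_i U i]].

Definition lower_dimB E : \bar R :=
  limf_einf (fun delta : R =>
    lne (covering_number E delta) * ((- ln delta)^-1)%:E)%E 0^'+.

Definition upper_dimB E : \bar R :=
  limf_esup (fun delta : R =>
    lne (covering_number E delta) * ((- ln delta)^-1)%:E)%E 0^'+.

Definition dimA E : \bar R :=
  ereal_inf [set s%:E | s in [set s | 0 <= s /\
    exists2 C : R, 0 < C & forall r rho : R,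
      0 < r -> r < rho -> rho <= Num.sqrt d%:R ->
      (ereal_sup [set covering_number (E `&` cball x rho) r | x in E]
         <= (C * (rho / r) `^ s)%:E)%E]].

End dimensions.

Section category.
Context {T : topologicalType}.

Definition nowhere_dense (A : set T) : Prop := (closure A)° = set0.

Definition first_category (A : set T) : Prop :=
  exists2 F : nat -> set T, (forall k, nowhere_dense (F k)) &
    A = \bigcup_k F k.

Definition typical (P : set T) : Prop := first_category (~` P).

End category.

(* The sequences are indexed from 1: the values M 0 and N 0 are never used. *)
Section cantor_space.
Context (R : realType) (d : nat) (M N : nat -> nat).

Definition seq_prod (u : nat -> nat) (n : nat) : nat :=
  (\prod_(1 <= i < n.+1) u i)%N.

Definition mesh (n : nat) : R := (seq_prod M n)%:R^-1.

Definition cube (n : nat) (i : 'I_d -> nat) : set 'rV[R]_d :=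
  [set x | forall l, (i l)%:R * mesh n <= x 0 l <= (i l).+1%:R * mesh n].

Definition cubes (n : nat) : set (set 'rV[R]_d) :=
  [set cube n i | i in [set i | forall l, (i l < seq_prod M n)%N]].

(* C n is the family of the cubes of level n that are chosen. *)
Definition construction (C : nat -> set (set 'rV[R]_d)) : Prop :=
  [/\ C 1%N `<=` cubes 1, C 1%N #= `I_(N 1%N) &
      forall n, (0 < n)%N ->
        (forall Q', C n.+1 Q' -> cubes n.+1 Q' /\ exists2 Q, C n Q & Q' `<=` Q)
        /\ (forall Q, C n Q -> [set Q' | C n.+1 Q' /\ Q' `<=` Q] #= `I_(N n.+1))].

Definition is_cantor_set (E : set 'rV[R]_d) : Prop :=
  exists2 C, construction C & E = \bigcap_n \bigcup_(Q in C n.+1) Q.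

Definition Omega : Type := {E : set 'rV[R]_d | is_cantor_set E}.

Definition cantor_set_of (E : Omega) : set 'rV[R]_d := sval E.

HB.instance Definition _ := gen_eqMixin Omega.
HB.instance Definition _ := gen_choiceMixin Omega.

Definition Omega_ball (E : Omega) (e : R) : set Omega :=
  [set F | (hausdorff_dist (cantor_set_of E) (cantor_set_of F) < e%:E)%E].

Lemma Omega_ball_center (E : Omega) (e : R) : 0 < e -> Omega_ball E e E.
Proof. by move=> e0; exact: le_lt_trans (hausdorff_distxx _) _. Qed.

Lemma Omega_ball_sym (E F : Omega) (e : R) :
  Omega_ball E e F -> Omega_ball F e E.
Proof. by rewrite /Omega_ball/= hausdorff_dist_sym. Qed.

Lemma Omega_ball_triangle (E F G : Omega) (e1 e2 : R) :
  Omega_ball E e1 F -> Omega_ball F e2 G -> Omega_ball E (e1 + e2) G.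
Proof. exact: hausdorff_dist_triangle. Qed.

HB.instance Definition _ :=
  hasNbhs.Build Omega (nbhs_ (entourage_ Omega_ball)).

HB.instance Definition _ := @Nbhs_isPseudoMetric.Build R Omega
  (entourage_ Omega_ball) erefl Omega_ball
  Omega_ball_center Omega_ball_sym Omega_ball_triangle erefl.

Definition t_star : \bar R :=
  limn_einf (fun n => (ln (seq_prod N n)%:R /
    (- ln (mesh n.+1) - d%:R^-1 * ln (N n.+1)%:R))%:E).

Definition s_two : \bar R :=
  limn_esup (fun n => (ln (seq_prod N n.+1)%:R /
    (- ln (mesh n) + d%:R^-1 * ln (N n.+1)%:R))%:E).

End cantor_space.

(* Main.v *)
(** A set of [Omega] is coded by its tree of cube indices, [T n] listing the
    chosen cubes of level [n]. Write [r] for the mesh, [P] for the number of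
    cubes and [N] for [N n.+1].

    Every set of [Omega] satisfies [t_star <= dimH] and [upper_dimB <= s_two]:
    a set of diameter [rho] between [r n.+1] and [r n] meets at most
    [min (c N) (c (rho / r n.+1)^d)] cubes of level [n.+1], whence the mass
    distribution bound [c rho^s] for the uniform measure as soon as
    [P n >= (r n.+1 * N^(1/d))^-s] eventually; dually the set is covered by [P n.+1]
    cubes of side [r n.+1], or by subdividing the [P n] cubes of side [r n].

    The other inequalities hold typically because, for prescribed positions of
    the subcubes inside every cube, a typical set uses these positions at
    infinitely many levels of any given infinite set of levels. Packing the [N]
    subcubes in a block gives a cover by [P n] sets of size [r n.+1 * N^(1/d)],
    hence [lower_dimB <= t_star], and a full block of about [N] subcubes, hence
    [dimA >= d]. Spreading them evenly gives [P n.+1] pieces at mutual distance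
    about [r n * N^(-1/d)], hence [dimP >= s_two] by a Baire argument. *)
Require Import Defs.
From mathcomp Require Import all_boot all_order all_algebra.
From mathcomp Require Import all_classical all_reals all_analysis.
From mathcomp Require Import ring lra zify.
Set Implicit Arguments.
Unset Strict Implicit.
Unset Printing Implicit Defensive.
Import Order.TTheory GRing.Theory Num.Theory.
Import numFieldNormedType.Exports.
Local Open Scope classical_set_scope.
Local Open Scope card_scope.
Local Open Scope ring_scope.

(** * Trees of cubes *)

Section trees.
Context {d : nat}.
Local Notation W := {ffun 'I_d -> nat}.
Implicit Types (q o : W) (K n j k : nat).
Local Open Scope nat_scope.

(** The Hausdorff distance does not see which closed cubes were chosen: neighbours share faces, so a
    set may have several trees, and nearby sets may use different cubes. Hence [typical_offsets]
    speaks of every tree of a set, and its proof approximates by sets having a point well inside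
    each cube of the relevant level. No measure is built. The mass of a set is the share of the
    cubes of a fine level that it meets, compactness is Koenig's lemma on the tree, and the Baire
    argument is a nested sequence of cubes. The equalities close two chains. In
    [t_star <= dimH <= lower_dimB <= t_star] only the last inequality needs a typical set; in
    [s_two <= dimP <= upper_dimB <= s_two] only the first does. *)

Definition box K : seq W :=
  [seq [ffun l => nat_of_ord (f l)] | f : {ffun 'I_d -> 'I_K}].

Lemma mem_box K q : (q \in box K) = [forall l, q l < K].
Proof.
rewrite /box; apply/fintype.imageP/forallP => [[f _ ->] l|qK]; first by rewrite ffunE.
exists [ffun l => Ordinal (qK l)] => //.
by apply/ffunP => l; rewrite !ffunE.
Qed.

Lemma box_uniq K : uniq (box K).
Proof.
rewrite map_inj_uniq ?enum_uniq// => f g /ffunP fg.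
by apply/ffunP => l; apply: val_inj; have := fg l; rewrite !ffunE.
Qed.

Lemma size_box K : size (box K) = K ^ d.
Proof. by rewrite size_map -cardE card_ffun !card_ord. Qed.

Lemma size_le_box (s : seq W) (a : 'I_d -> nat) K : uniq s ->
  (forall q, q \in s -> forall l, a l <= q l < a l + K) -> size s <= K ^ d.
Proof.
move=> us sK; rewrite -size_box.
pose f q : W := [ffun l => q l - a l].
rewrite -(size_map f); apply: uniq_leq_size.
  rewrite map_inj_in_uniq// => q q' /sK qK /sK qK' /ffunP qq'.
  apply/ffunP => l; have := qq' l; rewrite /f !ffunE.
  have /andP[h1 _] := qK l; have /andP[h2 _] := qK' l.
  by move=> e; rewrite -(subnK h1) e subnK.
move=> _ /mapP[q /sK qK ->]; rewrite mem_box; apply/forallP => l.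
by rewrite ffunE; have /andP[h1 h2] := qK l; rewrite ltn_subLR.
Qed.

Lemma uniq_between (A B : seq W) m : uniq A -> uniq B -> {subset A <= B} ->
  size A <= m <= size B ->
  exists S, [/\ uniq S, size S = m, {subset A <= S} & {subset S <= B}].
Proof.
move=> uA uB AB /andP[Am mB].
pose B' := [seq x <- B | x \notin A].
have uB' : uniq B' by exact: filter_uniq.
have sB' : size A + size B' = size B.
  have/(perm_size) <- : perm_eq (A ++ B') B; last by rewrite size_cat.
  apply: uniq_perm => //.
    rewrite cat_uniq uA uB' andbT/= -all_predC.
    by apply/allP => x; rewrite mem_filter => /andP[].
  move=> x; rewrite mem_cat mem_filter; case: (boolP (x \in A)) => //= xA.
  by rewrite AB.
exists (A ++ take (m - size A) B'); split.
- rewrite cat_uniq uA take_uniq// andbT/= -all_predC.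
  by apply/allP => x /mem_take; rewrite mem_filter => /andP[].
- by rewrite size_cat size_takel ?subnKC// leq_subLR sB'.
- by move=> x xA; rewrite mem_cat xA.
- move=> x; rewrite mem_cat => /orP[/AB//|/mem_take].
  by rewrite mem_filter => /andP[].
Qed.

Context (M N : nat -> nat).
Local Notation P := (seq_prod N).

Lemma seq_prod0 (u : nat -> nat) : seq_prod u 0 = 1.
Proof. by rewrite /seq_prod big_nil. Qed.

Lemma seq_prodS (u : nat -> nat) n : seq_prod u n.+1 = seq_prod u n * u n.+1.
Proof. by rewrite /seq_prod big_nat_recr. Qed.

Lemma seq_prod_gt0 (u : nat -> nat) n : (forall k, 0 < k -> 0 < u k) ->
  0 < seq_prod u n.
Proof.
move=> u0; elim: n => [|n IH]; first by rewrite seq_prod0.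
by rewrite seq_prodS muln_gt0 IH u0.
Qed.

Definition parent n q : W := [ffun l => q l %/ M n.+1].

Definition child n q o : W := [ffun l => M n.+1 * q l + o l].

Fixpoint ancestor n j q : W :=
  if j is j'.+1 then ancestor n j' (parent (n + j') q) else q.

Definition root_index : W := [ffun=> 0].

(* Unlike in [construction], there is a level 0, the unit cube. *)
Definition tree (T : nat -> seq W) : Prop :=
  [/\ T 0 = [:: root_index], forall n, uniq (T n),
      forall n q, q \in T n.+1 -> parent n q \in T n &
      forall n q, q \in T n ->
        count [pred q' | parent n q' == q] (T n.+1) = N n.+1].

Definition extend n (s S : seq W) : seq W := [seq child n q o | q <- s, o <- S].

Definition offsets n (S : seq W) : Prop :=
  [/\ uniq S, size S = N n.+1 & {subset S <= box (M n.+1)}].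

Section fixed_tree.
Variable T : nat -> seq W.
Hypothesis treeT : tree T.

Lemma count_children n (a : pred W) :
  count [pred q | a (parent n q)] (T n.+1) = count a (T n) * N n.+1.
Proof.
have [_ uT pT cT] := treeT.
rewrite -!sum1_count big_mkcond/=.
under eq_big_seq => q' q'T.
  have -> : (if a (parent n q') then 1 else 0) =
      \sum_(q <- T n | a q) (parent n q' == q).
    rewrite big_mkcond/= (bigD1_seq (parent n q'))/= ?pT//.
    rewrite eqxx big1 ?addn0// => q qq'.
    by rewrite eq_sym (negbTE qq'); case: ifP.
  over.
rewrite exchange_big/= big_distrl/= big_seq_cond [RHS]big_seq_cond.
apply: eq_bigr => q /andP[qT _].
rewrite mul1n -(cT _ _ qT) -sum1_count [RHS]big_mkcond/=.
by apply: eq_bigr => i _; case: (_ == _).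
Qed.

(** This is the uniform measure, written without division: the cubes descending from those that
    satisfy [a] form the same share of level [n + j] as [a] does of level [n]. *)
Lemma count_descendants n j (a : pred W) :
  count [pred q | a (ancestor n j q)] (T (n + j)) * P n =
  count a (T n) * P (n + j).
Proof.
elim: j a => [|j IH] a; first by rewrite addn0.
rewrite addnS (count_children (n + j) [pred q | a (ancestor n j q)]).
by rewrite mulnAC IH -mulnA -seq_prodS.
Qed.

Lemma size_tree n : size (T n) = P n.
Proof.
have := count_descendants 0 n predT.
by rewrite add0n seq_prod0 muln1; have [-> _ _ _] := treeT; rewrite mul1n count_predT.
Qed.

Lemma ancestor_tree n j q : q \in T (n + j) -> ancestor n j q \in T n.
Proof.
have [_ _ pT _] := treeT.
elim: j q => [|j IH] q; first by rewrite addn0.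
by rewrite addnS => /pT/IH.
Qed.

Lemma has_descendant n j q : (forall k, 0 < k -> 0 < N k) ->
  q \in T n -> exists2 q', q' \in T (n + j) & ancestor n j q' = q.
Proof.
move=> N0; have [_ _ _ cT] := treeT.
elim: j q n => [|j IH] q n qT; first by exists q; rewrite ?addn0.
have [q1 q1T <-] := IH _ _ qT.
have := cT _ _ q1T => c1.
have : has [pred q' | parent (n + j) q' == q1] (T (n + j).+1).
  by rewrite has_count c1 N0.
by move=> /hasP[q2 q2T /eqP q21]; exists q2; rewrite ?addnS//= q21.
Qed.

End fixed_tree.

Lemma ancestorD n i j q :
  ancestor n (i + j) q = ancestor n i (ancestor (n + i) j q).
Proof. by elim: j q => [|j IH] q; rewrite ?addn0// addnS/= IH addnA. Qed.

Section extension.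
Hypothesis M0 : forall k, 0 < k -> 0 < M k.

Lemma parent_child n q o : o \in box (M n.+1) -> parent n (child n q o) = q.
Proof.
rewrite mem_box => /forallP oM; apply/ffunP => l.
by rewrite !ffunE mulnC divnMDl ?M0// divn_small// addn0.
Qed.

Lemma child_inj n q o q' o' : o \in box (M n.+1) -> o' \in box (M n.+1) ->
  child n q o = child n q' o' -> q = q' /\ o = o'.
Proof.
move=> ob ob' e.
have qq' : q = q' by rewrite -(parent_child q ob) e parent_child.
split=> //; apply/ffunP => l; have /ffunP/(_ l) := e.
by rewrite !ffunE qq' => /addnI.
Qed.

Lemma mem_extend n s S q : q \in extend n s S ->
  exists q' o, [/\ q' \in s, o \in S & q = child n q' o].
Proof. by move=> /allpairsP[[q' o]/= [? ? ?]]; exists q', o. Qed.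

Lemma extend_uniq n s S : uniq s -> offsets n S -> uniq (extend n s S).
Proof.
move=> us [uS _ Sb]; apply: allpairs_uniq => //.
move=> [q o] [q' o'] /allpairsP[[x y]/= [_ yS e]].
move=> /allpairsP[[x' y']/= [_ yS' e']].
case: e e' => -> -> [-> ->] e.
by have [-> ->] := child_inj (Sb _ yS) (Sb _ yS') e.
Qed.

Lemma count_extend n s S q : uniq s -> offsets n S -> q \in s ->
  count [pred q' | parent n q' == q] (extend n s S) = N n.+1.
Proof.
move=> us oS qs; have [uS sS Sb] := oS.
rewrite -sS -(size_map (child n q) S) -size_filter; apply: perm_size.
apply: uniq_perm.
- exact: filter_uniq (extend_uniq us oS).
- rewrite map_inj_in_uniq// => o o' /Sb oS1 /Sb oS2 e.
  by have [] := child_inj oS1 oS2 e.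
- move=> x; rewrite mem_filter/=; apply/andP/mapP.
  + move=> [/eqP px /mem_extend[q' [w [_ wS xE]]]]; exists w => //.
    by rewrite -px xE parent_child// Sb.
  + move=> [w wS ->]; rewrite parent_child ?eqxx ?Sb//; split=> //.
    by apply/allpairsP; exists (q, w).
Qed.

(** Used for density in [Omega]: the first [n] levels of [T] keep the set close to the given one,
    while all later positions can be prescribed. *)
Fixpoint graft (T : nat -> seq W) n (S : nat -> seq W) k : seq W :=
  if k is k'.+1 then
    if k' < n then T k else extend k' (graft T n S k') (S k')
  else T 0.

Lemma graft_le T n S k : k <= n -> graft T n S k = T k.
Proof. by case: k => //= k ->. Qed.

Lemma graft_ge T n S k : n <= k ->
  graft T n S k.+1 = extend k (graft T n S k) (S k).
Proof. by move=> nk /=; rewrite ltnNge nk. Qed.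

Lemma tree_graft T n S : tree T -> (forall k, offsets k (S k)) ->
  tree (graft T n S).
Proof.
move=> [T0 uT pT cT] oS.
have uG k : uniq (graft T n S k).
  elim: k => [|k IH] /=; first by rewrite T0.
  by case: ifP => // _; exact: extend_uniq.
split=> // k q.
- have [kn|nk] := ltnP k n.
    by rewrite !graft_le// 1?ltnW// => /pT.
  rewrite graft_ge// => /mem_extend[q' [w [qk wS ->]]].
  by have [_ _ Sb] := oS k; rewrite parent_child// Sb.
- have [kn|nk] := ltnP k n.
    by rewrite !graft_le// 1?ltnW// => /cT.
  by rewrite graft_ge// => qk; exact: count_extend.
Qed.

End extension.

End trees.

(** * Cubes and their limit points *)

Section euclidean_diameter.
Context {R : realType} {d : nat}.
Implicit Types (x y : 'rV[R]_d) (A B : set 'rV[R]_d) (a : R).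

Lemma coord_le_eudist x y l : `|x 0 l - y 0 l| <= eudist x y.
Proof.
rewrite -sqrtr_sqr /eudist ler_sqrt; last first.
  by apply: sumr_ge0 => i _; exact: sqr_ge0.
rewrite (bigD1 l)//= lerDl; apply: sumr_ge0 => i _; exact: sqr_ge0.
Qed.

Lemma eudist_le x y a : 0 <= a -> (forall l, `|x 0 l - y 0 l| <= a) ->
  eudist x y <= Num.sqrt d%:R * a.
Proof.
move=> a0 xya; rewrite -[a in leRHS]ger0_norm// -sqrtr_sqr -sqrtrM ?ler0n//.
rewrite ler_sqrt ?mulr_ge0 ?sqr_ge0//.
rewrite -[d in leRHS]card_ord -[in leRHS]sumr_const mulr_suml.
by apply: ler_sum => l _; rewrite mul1r -real_normK ?num_real// lerXn2r ?nnegrE.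
Qed.

Lemma ediam_le A a : 0 <= a -> (forall x y, A x -> A y -> eudist x y <= a) ->
  (ediam A <= a%:E)%E.
Proof.
move=> a0 Aa; apply: ge_ereal_sup => _ [->|[x [y [Ax Ay ->]]]].
  by rewrite lee_fin.
by rewrite lee_fin; exact: Aa.
Qed.

Lemma eudist_le_ediam A x y : A x -> A y -> ((eudist x y)%:E <= ediam A)%E.
Proof. by move=> Ax Ay; apply: ereal_sup_ubound; right; exists x, y. Qed.

Lemma ediam_ge0 A : (0 <= ediam A)%E.
Proof. by apply: ereal_sup_ubound; left. Qed.

End euclidean_diameter.

Section cubes.
Context {R : realType} {d : nat} {M N : nat -> nat}.
Hypothesis M_ge2 : forall k, (1 <= k)%N -> (2 <= M k)%N.
Local Notation W := {ffun 'I_d -> nat}.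
Local Notation mesh := (mesh R M).
Local Notation cube := (@cube R d M).
Implicit Types (q : W) (T : nat -> seq W) (x y : 'rV[R]_d) (U : set 'rV[R]_d).

Let M_gt0 k : (0 < k)%N -> (0 < M k)%N.
Proof. by move=> k0; rewrite (leq_trans _ (M_ge2 k0)). Qed.

Lemma mesh_gt0 n : 0 < mesh n.
Proof. by rewrite invr_gt0 ltr0n seq_prod_gt0. Qed.
Local Hint Resolve mesh_gt0 : core.

Lemma mesh0 : mesh 0 = 1.
Proof. by rewrite /Defs.mesh seq_prod0 invr1. Qed.

Lemma meshS n : mesh n = (M n.+1)%:R * mesh n.+1.
Proof.
rewrite /Defs.mesh seq_prodS natrM invfM mulrC mulfVK//.
by rewrite pnatr_eq0 -lt0n M_gt0.
Qed.

Lemma mesh_half n : mesh n.+1 <= mesh n / 2.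
Proof.
rewrite ler_pdivlMr// mulrC [leRHS]meshS ler_pM2r// ler_nat.
exact: M_ge2.
Qed.

Lemma mesh_lt n : mesh n.+1 < mesh n.
Proof. by apply: le_lt_trans (mesh_half n) _; rewrite gtr_pMr ?invf_lt1 ?ltr1n. Qed.

Lemma mesh_le n m : (n <= m)%N -> mesh m <= mesh n.
Proof.
move=> /subnK <-; elim: (m - n)%N => // k IH.
by rewrite addSn (le_trans _ IH)// ltW// mesh_lt.
Qed.

Lemma mesh_le1 n : mesh n <= 1.
Proof. by rewrite -mesh0 mesh_le. Qed.

Lemma mesh_le_pow n : mesh n <= 2^-1 ^+ n.
Proof.
elim: n => [|n IH]; first by rewrite mesh0.
apply: le_trans (mesh_half n) _; rewrite exprSr ler_pM2r ?invr_gt0//.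
Qed.

Lemma mesh_small (e : R) : 0 < e -> exists n0, forall n, (n0 <= n)%N -> mesh n < e.
Proof.
move=> e0; have h : `|2^-1 : R| < 1 by rewrite ger0_norm ?invf_lt1 ?ltr1n.
have /cvgr0Pnorm_lt/(_ e e0)[n0 _ Hn] := cvg_expr h.
exists n0 => n /Hn; rewrite ger0_norm ?exprn_ge0//; exact/le_lt_trans/mesh_le_pow.
Qed.

Lemma mesh_bracket n0 (r : R) : 0 < r < mesh n0 ->
  exists k, [/\ (n0 <= k)%N, mesh k.+1 <= r & r < mesh k].
Proof.
move=> /andP[r0 rn0]; have ex : exists k, mesh k.+1 <= r.
  have [m Hm] := mesh_small r0.
  by exists m; apply/ltW/Hm.
case: (ex_minnP ex) => k hk mink.
have hk' : r < mesh k.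
  case: k hk mink => [|k] hk mink.
    by apply: lt_le_trans rn0 _; exact: mesh_le.
  by rewrite ltNge; apply/negP => /mink; rewrite ltnn.
exists k; split=> //; rewrite leqNgt; apply/negP => kn0.
have := le_lt_trans (le_trans (mesh_le kn0) hk) rn0.
by rewrite ltxx.
Qed.

Lemma ediam_cube n q : (ediam (cube n q) <= (Num.sqrt d%:R * mesh n)%:E)%E.
Proof.
apply: ediam_le => [|x y xq yq]; first by rewrite mulr_ge0 ?sqrtr_ge0 ?ltW.
apply: eudist_le => [|l]; first exact: ltW.
have /andP[x1 x2] := xq l; have /andP[y1 y2] := yq l.
rewrite -natr1 mulrDl mul1r in x2; rewrite -natr1 mulrDl mul1r in y2.
by rewrite ler_norml; apply/andP; split; lra.
Qed.

Lemma cube_parent n q : cube n.+1 q `<=` cube n (parent M n q).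
Proof.
move=> x xq l; have /andP[x1 x2] := xq l; rewrite ffunE.
apply/andP; split.
  apply: le_trans x1; rewrite (meshS n) mulrA ler_pM2r// -natrM ler_nat.
  exact: leq_trunc_div.
apply: (le_trans x2); rewrite (meshS n) mulrA ler_pM2r// -natrM ler_nat.
by rewrite ltn_ceil// M_gt0.
Qed.

Lemma cube_ancestor n j q : cube (n + j) q `<=` cube n (ancestor M n j q).
Proof.
elim: j q => [|j IH] q; first by rewrite addn0.
by rewrite addnS => x /cube_parent/IH.
Qed.

Definition corner n q : 'rV[R]_d := \row_l ((q l)%:R * mesh n).

Lemma cube_corner n q : cube n q (corner n q).
Proof. by move=> l; rewrite mxE lexx ler_pM2r ?ler_nat /=. Qed.

Definition tree_set T : set 'rV[R]_d :=
  [set x | forall n, exists2 q, q \in T n & cube n q x].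

Definition cube_meets n U : pred W := [pred q : W | `[< exists2 x, U x & cube n q x >]].

Lemma cube_meetsP n U q : reflect (exists2 x, U x & cube n q x) (cube_meets n U q).
Proof. exact: asboolP. Qed.

(** Each coordinate of the point is the supremum of the corresponding corner coordinates. The levels
    [k i] may skip some, as the Baire argument requires; the skipped cubes are recovered as
    ancestors. *)
Lemma nested_point T (k : nat -> nat) (q : nat -> W) :
  tree M N T -> (forall i, (k i < k i.+1)%N) -> (forall i, q i \in T (k i)) ->
  (forall i, cube (k i.+1) (q i.+1) `<=` cube (k i) (q i)) ->
  exists2 x, tree_set T x & forall i, cube (k i) (q i) x.
Proof.
move=> tT kS qT nest.
have nestD i j : cube (k (i + j)%N) (q (i + j)%N) `<=` cube (k i) (q i).
  elim: j => [|j IH]; first by rewrite addn0.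
  by rewrite addnS => x /nest/IH.
pose c i : 'rV[R]_d := corner (k i) (q i).
have cub i j : cube (k i) (q i) (c (i + j)%N).
  exact/nestD/cube_corner.
have c_le i j l : c j 0 l <= ((q i) l).+1%:R * mesh (k i).
  have [ij|/ltnW ji] := leqP i j.
    by have /andP[_] := cub i (j - i)%N l; rewrite subnKC.
  have /andP[h _] := cub j (i - j)%N l; rewrite subnKC// in h.
  rewrite [c j]/c mxE (le_trans h)// mxE ler_pM2r// ler_nat//.
pose S l := [set c j 0 l | j in setT].
have hS l : has_sup (S l).
  split; first by exists (c 0%N 0 l), 0%N.
  by exists (((q 0%N) l).+1%:R * mesh (k 0%N)) => _ [j _ <-]; exact: c_le.
pose x : 'rV[R]_d := \row_l sup (S l).
have xin i : cube (k i) (q i) x.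
  move=> l; rewrite mxE; apply/andP; split.
    have -> : ((q i) l)%:R * mesh (k i) = c i 0 l by rewrite mxE.
    by apply: ub_le_sup; [case: (hS l)|exists i].
  apply: ge_sup => [|_ [j _ <-]]; first by case: (hS l).
  exact: c_le.
exists x => // n.
have kge i : (i <= k i)%N by elim: i => // i IH; exact: leq_ltn_trans (kS i).
have e : (n + (k n - n))%N = k n by rewrite subnKC.
exists (ancestor M n (k n - n) (q n)).
  by apply: (ancestor_tree tT); rewrite e.
by apply: cube_ancestor; rewrite e.
Qed.

Lemma tree_set_meets T n q : (forall k, (0 < k)%N -> (0 < N k)%N) ->
  tree M N T -> q \in T n -> exists2 x, tree_set T x & cube n q x.
Proof.
move=> N0 tT qT.
have /choice[f Hf] (iq : nat * W) : exists q', iq.2 \in T iq.1 ->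
    q' \in T iq.1.+1 /\ parent M iq.1 q' = iq.2.
  case: (boolP (iq.2 \in T iq.1)) => [q'T|_]; last by exists iq.2.
  have [q2] := has_descendant tT 1%N N0 q'T.
  by rewrite addn1/= addn0 => q2T pq2; exists q2.
pose c := fix c i := if i is i'.+1 then f ((n + i')%N, c i') else q.
have cT i : c i \in T (n + i)%N.
  elim: i => [|i IH]; first by rewrite addn0.
  by rewrite addnS; have [] := Hf (_, _) IH.
have [] := @nested_point T (addn n) c tT.
- by move=> i; rewrite addnS.
- exact: cT.
- move=> i; rewrite addnS => x /cube_parent.
  by have [_ ->] := Hf (_, _) (cT i).
by move=> x xT /(_ 0%N); rewrite addn0; exists x.
Qed.

(** All indices differ from that of one cube [q0] met by [U] by at most
    [k = floor (rho / mesh n) + 1] in each coordinate. They lie in a box of side [2 k + 1], at most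
    [2 rho / mesh n + 3], hence at most [5 rho / mesh n] as [mesh n <= rho]. *)
Lemma count_meets n U (s : seq W) (rho : R) : uniq s ->
  (forall x y, U x -> U y -> eudist x y <= rho) -> mesh n <= rho ->
  (count (cube_meets n U) s)%:R <= (5 * rho / mesh n) ^+ d.
Proof.
move=> us Urho nrho.
have rho0 : 0 < rho := lt_le_trans (mesh_gt0 n) nrho.
have [->|/negP] := eqVneq (count (cube_meets n U) s) 0%N.
  by rewrite exprn_ge0// divr_ge0 ?mulr_ge0 ?ltW.
rewrite -leqn0 => /negP; rewrite -ltnNge -has_count => /hasP[q0 _ /cube_meetsP[x0 Ux0 x0q0]].
pose k := (Num.truncn (rho / mesh n)).+1.
have rk : rho < k%:R * mesh n by rewrite -ltr_pdivrMr// truncnS_gt.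
have close q l : cube_meets n U q -> (q l <= q0 l + k)%N /\ (q0 l <= q l + k)%N.
  move=> /cube_meetsP[x Ux xq].
  have := le_trans (coord_le_eudist x x0 l) (Urho _ _ Ux Ux0).
  rewrite ler_norml => /andP[h1 h2].
  have /andP[x1 x2] := xq l; have /andP[y1 y2] := x0q0 l.
  split; rewrite -ltnS -(ltr_nat R) -(ltr_pM2r (mesh_gt0 n)).
    rewrite -addSn natrD mulrDl; lra.
  rewrite -addSn natrD mulrDl; lra.
apply: (@le_trans _ _ ((2 * k + 1) ^ d)%:R).
  rewrite ler_nat -size_filter.
  apply: (@size_le_box _ _ (fun l => q0 l - k)%N); first exact: filter_uniq.
  move=> q; rewrite mem_filter => /andP[mq _] l.
  have [h1 h2] := close q l mq; apply/andP; split; lia.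
have h0 : 0 <= 5 * rho / mesh n by rewrite divr_ge0 ?mulr_ge0 ?ltW.
rewrite natrX lerXn2r ?nnegrE ?ler0n//.
have h1 : (Num.truncn (rho / mesh n))%:R <= rho / mesh n.
  by rewrite truncn_le divr_ge0 ?ltW.
have h2 : 1 <= rho / mesh n by rewrite ler_pdivlMr ?mul1r.
rewrite natrD natrM /k -(natr1 (Num.truncn _)) -mulrA; lra.
Qed.

End cubes.

(** * Typical sets of Omega *)

Lemma card_eq_seq (T : eqType) (s : seq T) : uniq s -> [set` s] #= `I_(size s).
Proof.
move=> us.
have <- : (index^~ s) @` [set` s] = `I_(size s).
  apply/seteqP; split=> [_ [x /= xs <-]|i /= iss]; first by rewrite index_mem.
  have [x xs] : exists x, x \in s by case: s iss us => // x s; exists x; rewrite mem_head.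
  by exists (nth x s i); rewrite ?index_uniq//=; exact: mem_nth.
rewrite card_eq_sym; apply: inj_card_eq => x y; rewrite !inE /= => xs ys e.
by rewrite -(nth_index x xs) e nth_index.
Qed.

Lemma first_category_subset (T : topologicalType) (A : set T) (F : nat -> set T) :
  (forall k, nowhere_dense (F k)) -> A `<=` \bigcup_k F k -> first_category A.
Proof.
move=> nF AF; exists (fun k => F k `&` A) => [k|].
  apply/seteqP; split=> // x /(interiorS (closureS (@subIsetl _ (F k) A))).
  by rewrite (nF k).
by rewrite -setI_bigcupl; apply/esym/setIidPr.
Qed.

Section omega.
Context {R : realType} {d : nat} {M N : nat -> nat}.
Hypothesis d_gt0 : (0 < d)%N.
Hypothesis M_ge2 : forall k, (1 <= k)%N -> (2 <= M k)%N.
Hypothesis N_bounds : forall k, (1 <= k)%N -> (1 <= N k <= M k ^ d)%N.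
Local Notation W := {ffun 'I_d -> nat}.
Local Notation mesh := (mesh R M).
Local Notation cube := (@cube R d M).
Local Notation tree_set := (@tree_set R d M).
Implicit Types (q : W) (T : nat -> seq W) (x y : 'rV[R]_d) (E : Omega R d M N).

Let M_gt0 k : (0 < k)%N -> (0 < M k)%N.
Proof. by move=> k0; rewrite (leq_trans _ (M_ge2 k0)). Qed.

Let N_gt0 k : (0 < k)%N -> (0 < N k)%N.
Proof. by move=> /N_bounds/andP[]. Qed.

Let mesh_gt0 n : 0 < mesh n. Proof. exact: mesh_gt0. Qed.

(** A point on a face lies in several closed cubes; only an interior point determines its cube. *)
Lemma cube_open_inj n q q' y : cube n q' y ->
  (forall l, (q l)%:R * mesh n < y 0 l < (q l).+1%:R * mesh n) -> q' = q.
Proof.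
move=> yq' yq; apply/ffunP => l.
have /andP[a1 a2] := yq' l; have /andP[b1 b2] := yq l.
have := le_lt_trans a1 b2; have := lt_le_trans b1 a2.
by rewrite !ltr_pM2r// !ltr_nat !ltnS => h1 h2; apply/eqP; rewrite eqn_leq h1 h2.
Qed.

Lemma cube_sub_parent n q q' : cube n.+1 q' `<=` cube n q -> parent M n q' = q.
Proof.
(* The centre of the small cube is interior to the cube of its parent, so no other closed cube of
   level [n] contains it. *)
move=> sub; pose y : 'rV[R]_d := \row_l (((q' l)%:R + 2^-1) * mesh n.+1).
have yq' : cube n.+1 q' y.
  by move=> l; rewrite mxE !ler_pM2r// -(natr1 (q' l)); apply/andP; split; lra.
suff : q = parent M n q' by [].
apply: (@cube_open_inj n _ _ y) => [|l]; first exact: sub.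
rewrite mxE ffunE (meshS M_ge2 n) !mulrA !ltr_pM2r// -!natrM.
have h1 := leq_trunc_div (q' l) (M n.+1).
have h2 := ltn_ceil (q' l) (M_gt0 (ltn0Sn n)).
rewrite -(ler_nat R) in h1; rewrite -(ler_nat R) -(natr1 (q' l)) in h2.
by apply/andP; split; lra.
Qed.

Lemma cube_inj n : {in setT &, injective (fun q => cube n q)}.
Proof.
move=> q q' _ _ e; apply/ffunP => l.
have : cube n q' (corner (M:=M) n q) by rewrite -e; exact: cube_corner.
have : cube n q (corner (M:=M) n q') by rewrite e; exact: cube_corner.
move=> /(_ l) + /(_ l); rewrite !mxE !ler_pM2r// !ler_nat.
by move=> /andP[h1 _] /andP[h2 _]; apply/eqP; rewrite eqn_leq h1 h2.
Qed.

Lemma tree_lt T n q l : tree M N T -> q \in T n -> (q l < seq_prod M n)%N.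
Proof.
move=> [T0 _ pT _]; elim: n q => [|n IH] q.
  by rewrite T0 inE => /eqP ->; rewrite ffunE seq_prod0.
move=> /pT/IH; rewrite ffunE seq_prodS => h.
by rewrite -ltn_divLR ?M_gt0.
Qed.

Lemma is_cantor_set_tree T : tree M N T -> is_cantor_set M N (tree_set T).
Proof.
move=> tT; have [T0 uT pT cT] := tT.
pose C n := [set cube n q | q in [set` T n]].
have cardC n q : q \in T n ->
    [set Q' | C n.+1 Q' /\ Q' `<=` cube n q] #= `I_(N n.+1).
  move=> qT; pose s := [seq q' <- T n.+1 | parent M n q' == q].
  have -> : [set Q' | C n.+1 Q' /\ Q' `<=` cube n q] =
      [set cube n.+1 q' | q' in [set` s]].
    apply/seteqP; split=> [_ [[q' /= q'T <-] /cube_sub_parent qE]|_ [q' + <-]].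
      by exists q' => //=; rewrite mem_filter qE eqxx.
    rewrite /= mem_filter => /andP[/eqP <- q'T]; split; first by exists q'.
    exact: cube_parent.
  rewrite -(cT _ _ qT) -size_filter -/s.
  apply: card_eq_trans (card_eq_seq (filter_uniq _ (uT _))).
  by apply: inj_card_eq => x y _ _; apply: cube_inj; rewrite inE.
exists C.
  split.
  - move=> _ [q qT <-]; exists q => // l; exact: tree_lt tT qT.
  (* The condition on level 1 is the case [n = 0] of [cardC], with the unit cube as parent. *)
  - rewrite (_ : C 1%N = [set Q' | C 1%N Q' /\ Q' `<=` cube 0 (root_index)]).
      by apply: cardC; rewrite T0 mem_head.
    apply/seteqP; split=> [Q CQ|Q []//]; split=> //.
    case: CQ => q qT <-; have := pT _ _ qT.
    by rewrite T0 inE => /eqP <-; exact: cube_parent.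
  - move=> n n0; split=> [_ [q qT <-]|_ [q qT <-]]; last exact: cardC.
    split; first by exists q => // l; exact: tree_lt tT qT.
    exists (cube n (parent M n q)); last exact: cube_parent.
    by exists (parent M n q) => //; exact: pT.
apply/seteqP; split=> [x xT n _|x xC n].
  by have [q qT xq] := xT n.+1; exists (cube n.+1 q) => //; exists q.
have [_ [q qT <-] xq] := xC n I.
by exists (parent M n q); [exact: pT|exact: cube_parent].
Qed.

Lemma is_cantor_setP (A : set 'rV[R]_d) : is_cantor_set M N A ->
  exists2 T, tree M N T & A = tree_set T.
Proof.
move=> [C [C1 cC1 CS] AE].
have Ccubes n Q : C n.+1 Q -> cubes M n.+1 Q.
  by case: n => [/C1//|n CQ]; have [+ _] := CS _ (ltn0Sn n) => /(_ _ CQ)[].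
(* Filtering a finite box of indices turns the family [C n] into a list and loses nothing, since
   chosen cubes belong to [cubes M n]. The root is added by hand. *)
pose T n := if n is 0%N then [:: root_index] else
  [seq q : W <- box (seq_prod M n) | `[< C n (cube n q) >]] : seq W.
have memT n q : (q \in T n.+1) <-> C n.+1 (cube n.+1 q).
  rewrite mem_filter; split=> [/andP[/asboolP]//|Cq].
  apply/andP; split; first exact/asboolP.
  rewrite mem_box; apply/forallP => l.
  have [i ib iE] := Ccubes _ _ Cq.
  have {}iE : cube n.+1 [ffun l => i l] = cube n.+1 q.
    by rewrite -iE; apply/seteqP; split=> x xi l'; have := xi l'; rewrite ffunE.
  by rewrite -(cube_inj _ _ iE) ?inE// ffunE.
have uT n : uniq (T n) by case: n => // n; rewrite filter_uniq// box_uniq.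
have TC n Q : C n.+1 Q -> exists2 q, q \in T n.+1 & Q = cube n.+1 q.
  move=> CQ; have [i ib iE] := Ccubes _ _ CQ.
  have {}iE : Q = cube n.+1 [ffun l => i l].
    by rewrite -iE; apply/seteqP; split=> x xi l'; have := xi l'; rewrite ffunE.
  by exists [ffun l => i l] => //; apply/memT; rewrite -iE.
have par0 q : q \in T 1%N -> parent M 0 q = root_index.
  rewrite mem_filter mem_box => /andP[_ /forallP ql]; apply/ffunP => l.
  rewrite !ffunE divn_small//; have := ql l.
  by rewrite seq_prodS seq_prod0 mul1n.
have pT n q : q \in T n.+1 -> parent M n q \in T n.
  case: n => [/par0 ->|n /memT Cq]; first exact: mem_head.
  have [/(_ _ Cq)[_ [Q CQ qQ]] _] := CS _ (ltn0Sn n).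
  by have [q' q'T QE] := TC _ _ CQ; rewrite QE in qQ; rewrite (cube_sub_parent qQ).
have cardT n q (B : set (set 'rV[R]_d)) : q \in T n ->
    B = [set cube n.+1 q' | q' in [set` [seq q' <- T n.+1 | parent M n q' == q]]] ->
    B #= `I_(N n.+1) -> count [pred q' | parent M n q' == q] (T n.+1) = N n.+1.
  move=> qT -> cB; apply/card_eq_II; rewrite -size_filter.
  apply: card_eq_trans cB; apply: card_esym.
  apply: card_eq_trans (card_eq_seq (filter_uniq _ (uT _))).
  by apply: inj_card_eq => x y _ _; apply: cube_inj; rewrite inE.
have tT : tree M N T.
  split=> // -[|n] q qT.
    rewrite inE in qT; rewrite (eqP qT).
    apply: (cardT _ _ (C 1%N)) => //; first exact: mem_head.
    apply/seteqP; split=> [Q /TC[q' q'T ->]|_ [q' /= + <-]].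
      by exists q' => //=; rewrite mem_filter par0// eqxx.
    by rewrite mem_filter => /andP[_ /memT].
  have Cq := (memT _ _).1 qT.
  have [_ /(_ _ Cq) cQ] := CS _ (ltn0Sn n).
  apply: cardT cQ => //.
  apply/seteqP; split=> [Q [/TC[q' q'T ->] /cube_sub_parent e]|_ [q' /= + <-]].
    by exists q' => //=; rewrite mem_filter e eqxx.
  rewrite mem_filter => /andP[/eqP <- /memT]; split=> //; exact: cube_parent.
exists T => //; rewrite AE; apply/seteqP; split=> [x xC n|x xT n _].
  have [Q /TC[q qT ->] xq] := xC n I.
  by exists (parent M n q); [exact: pT|exact: cube_parent].
by have [q /memT Cq xq] := xT n.+1; exists (cube n.+1 q).
Qed.

(** [A] prescribes some positions and [K] confines the remaining ones. Blocks need both; spread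
    positions and inner points take [K = M n.+1]. *)
Lemma offsets_exist n (A : seq W) K : uniq A -> {subset A <= box K} ->
  (K <= M n.+1)%N -> (size A <= N n.+1 <= K ^ d)%N ->
  exists S, [/\ offsets M N n S, {subset A <= S} & {subset S <= box K}].
Proof.
move=> uA AK KM; rewrite -size_box.
move=> /(uniq_between uA (box_uniq _) AK)[S [uS sS AS SK]].
exists S; split=> //; split=> // q /SK; rewrite !mem_box => /forallP qK.
by apply/forallP => l; exact: leq_trans KM.
Qed.

Lemma hausdorff_dist_tree T T' n : tree M N T -> tree M N T' -> T n = T' n ->
  (hausdorff_dist (tree_set T) (tree_set T') <= (Num.sqrt d%:R * mesh n)%:E)%E.
Proof.
move=> tT tT' TT'; apply: ereal_inf_lbound.
have near_tree T1 T2 a : tree M N T2 -> T1 n = T2 n -> tree_set T1 a ->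
    exists2 b, tree_set T2 b & eudist a b <= Num.sqrt d%:R * mesh n.
  move=> tT2 T12 /(_ n)[q]; rewrite T12 => qT2 aq.
  have [b bT2 bq] := tree_set_meets (R:=R) M_ge2 N_gt0 tT2 qT2.
  exists b => //; rewrite -lee_fin.
  by apply: (le_trans (eudist_le_ediam aq bq)); exact: ediam_cube.
exists (Num.sqrt d%:R * mesh n) => //; split.
- by rewrite mulr_ge0 ?sqrtr_ge0// ltW.
- by move=> a; exact: near_tree.
- by move=> b /(near_tree _ _ _ tT (esym TT'))[a aT ab]; exists a; rewrite // eudist_sym.
Qed.

(* The offsets [0] and then [M n.+2 - 1] lead to a cube of level [n.+2] at distance
   at least [mesh n.+2] from the boundary of the cube [q] of level [n]. *)
Lemma tree_set_inner T T' n q : tree M N T' ->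
  child M n.+1 (child M n q root_index) [ffun=> (M n.+2).-1] \in T n.+2 ->
  tree M N T ->
  (hausdorff_dist (tree_set T) (tree_set T') < (mesh n.+2)%:E)%E ->
  q \in T' n.
Proof.
move=> tT' qT tT /ereal_inf_lt[_ [e [e0 TT' _] <-]]; rewrite lte_fin => er.
have [x /TT'[y yT' xy] xq] := tree_set_meets (R:=R) M_ge2 N_gt0 tT qT.
have [q' q'T' yq'] := yT' n.
suff <- : q' = q by [].
apply: cube_open_inj yq' _ => l.
have xyl := le_lt_trans (le_trans (coord_le_eudist x y l) xy) er.
have := xq l; rewrite !ffunE addn0 => /andP[x1 x2].
rewrite ltr_norml in xyl; case/andP: xyl => d1 d2.
rewrite (meshS M_ge2 n) (meshS M_ge2 n.+1).
set a := M n.+2 in x1 x2 *; set b := M n.+1 in x1 x2 *; set r := mesh n.+2 in x1 x2 d1 d2 *.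
have a2 : (2 <= a)%N by exact: M_ge2.
have b2 : (2 <= b)%N by exact: M_ge2.
have r0 : 0 < r by exact: mesh_gt0.
rewrite !mulrA -!natrM.
have comm : (a * (b * q l) = q l * b * a)%N by rewrite mulnC [(b * _)%N]mulnC.
have e1 : (q l * b * a)%:R * r + r <= (a * (b * q l) + a.-1)%:R * r.
  rewrite -{2}[r]mul1r -mulrDl natr1 ler_pM2r// ler_nat.
  by rewrite comm -addn1 leq_add2l -ltnS prednK// ltnW.
have e2 : (a * (b * q l) + a.-1).+1%:R * r + r <= ((q l).+1 * b * a)%:R * r.
  rewrite -{2}[r]mul1r -mulrDl natr1 ler_pM2r// ler_nat.
  rewrite comm mulSn mulnDl [(b * a + _)%N]addnC -addn2 -addnA leq_add2l.
  apply: (@leq_trans (2 * a)%N); last by rewrite leq_mul2r b2 orbT.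
  by rewrite addn2 prednK ?(ltnW a2)// mul2n -addnn -addn1 leq_add2l ltnW.
by apply/andP; split; lra.
Qed.

(* The approximation keeps [n] levels of a given set, uses the offsets [S n] at
   level [n.+1], and then has a point well inside each cube of level [n.+1]; so
   every set close to it has the same cubes up to level [n.+1]. *)
Lemma typical_offsets (S : nat -> seq W) (G : nat -> nat -> Prop) :
  (forall n, offsets M N n (S n)) ->
  (forall m k, exists2 n, (k <= n)%N & G m n) ->
  typical [set E : Omega R d M N | forall T, tree M N T -> cantor_set_of E = tree_set T ->
    forall m, exists2 n, G m n & T n.+1 =i extend M n (T n) (S n)].
Proof.
move=> oS Ginf.
(* The exceptional sets, sorted by the first quantifier that fails; each [B m] is shown to be
   nowhere dense. *)
pose B m := [set E : Omega R d M N | exists T, [/\ tree M N T, cantor_set_of E = tree_set T &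
  forall n, G m n -> ~ (T n.+1 =i extend M n (T n) (S n))]].
apply: (@first_category_subset _ _ B); last first.
  move=> E /= /existsNP[T /not_implyP[tT /not_implyP[ET /existsNP[m /forall2NP h]]]].
  exists m => //; exists T; split=> // n Gn TE.
  by have [] := h n.
move=> m; apply/seteqP; split=> // E /nbhs_ballP[e /= e0 Ee].
have [T tT ET] := is_cantor_setP (svalP E).
(* The factor [d.+1] is a crude bound for the square root of [d] in [hausdorff_dist_tree]. *)
have [n0 Hn0] := mesh_small M_ge2 (divr_gt0 e0 (ltr0Sn R d)).
have [n n0n Gn] := Ginf m n0.
(* The offsets that [tree_set_inner] asks for below a cube of level [n.+1]: zero at step [n.+1], the
   last position at step [n.+2]. *)
pose c k : W := if k == n.+2 then [ffun=> (M k.+1).-1] else root_index.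
have /choice[D HD] k : exists S', offsets M N k S' /\ c k \in S'.
  have [| |//| |S' [oS' cS' _]] := @offsets_exist k [:: c k] (M k.+1).
  - by [].
  - move=> q; rewrite inE => /eqP ->; rewrite mem_box; apply/forallP => l.
    by rewrite /c; case: ifP => _; rewrite ffunE ?prednK// M_gt0.
  - exact: N_bounds.
  by exists S'; split=> //; apply: cS'; rewrite mem_head.
pose S' k := if k == n then S k else D k.
have oS' k : offsets M N k (S' k).
  by rewrite /S'; case: ifP => // _; have [] := HD k.
pose T' := graft M T n S'.
have tT' : tree M N T' := tree_graft M_gt0 n tT oS'.
pose F : Omega R d M N := exist _ _ (is_cantor_set_tree tT').
have : closure (B m) F.
  apply: Ee; rewrite /ball/= /Omega_ball /= /cantor_set_of ET.
  apply: le_lt_trans (@hausdorff_dist_tree T T' n tT tT' _) _.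
    by rewrite /T' graft_le.
  have := Hn0 _ n0n; rewrite lte_fin ltr_pdivlMr ?ltr0Sn// mulrC.
  apply: le_lt_trans; rewrite ler_pM2r//.
  rewrite -[leRHS]ger0_norm// -sqrtr_sqr ler_sqrt ?sqr_ge0// -natrX ler_nat; nia.
move=> /(_ (ball F (mesh n.+3)))[|G0 [[T2 [tT2 G0E nT2]] FG0]].
  exact: nbhsx_ballx.
apply: (nT2 _ Gn); have FG :
    (hausdorff_dist (tree_set T') (tree_set T2) < (mesh n.+3)%:E)%E.
  by rewrite -G0E; exact: FG0.
have T'S k : (n <= k)%N -> T' k.+1 = extend M k (T' k) (S' k).
  exact: graft_ge.
have T'T2 : {subset T' n.+1 <= T2 n.+1}.
  move=> q qT'; apply: (tree_set_inner tT2 _ tT' FG).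
  rewrite T'S; last by lia.
  apply/allpairsP; exists (child M n.+1 q root_index, [ffun=> (M n.+3).-1]); split=> //=.
    rewrite T'S//.
    apply/allpairsP; exists (q, root_index); split=> //=.
    have [_] := HD n.+1.
    by rewrite /S' (gtn_eqF (ltnSn n)) /c (ltn_eqF (ltnSn n.+1)).
  have [_] := HD n.+2.
  by rewrite /S' (gtn_eqF (ltnW (ltnSn n.+1))) /c eqxx.
(* All trees have equally many cubes at a given level, so an inclusion between levels is an
   equality. *)
have sizeT2 k : size (T2 k) = size (T' k) by rewrite (size_tree tT2) (size_tree tT').
have T'T2n : {subset T' n <= T2 n}.
  move=> q /(has_descendant tT' 1%N N_gt0)[q']; rewrite addn1/= addn0 => q'T' <-.
  by have [_ _ pT2 _] := tT2; exact/pT2/T'T2.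
have eqT k : {subset T' k <= T2 k} -> T' k =i T2 k.
  move=> sub; have [_ uT' _ _] := tT'.
  by have [] := uniq_min_size (uT' k) sub; rewrite ?sizeT2.
move=> q; rewrite -(eqT _ T'T2) T'S// /S' eqxx.
by apply/allpairsP/allpairsP => -[[q1 w] /= [q1T wS ->]]; exists (q1, w); split=> //;
  move: q1T => /=; rewrite (eqT _ T'T2n).
Qed.

End omega.

(** * Dimension inequalities valid for every set *)

Lemma lee_real_above (R : realType) (x y : \bar R) :
  (forall s : R, y < s%:E -> x <= s%:E)%E -> (x <= y)%E.
Proof.
case: y => [r H|_|H]; [|by rewrite leey|].
  by apply/lee_addgt0Pr => e e0; apply: H; rewrite lte_fin ltrDl.
case: x H => [r|/(_ 0)|//]; last by rewrite ltNyr leNgt ltry => /(_ erefl).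
by move=> /(_ (r - 1)); rewrite ltNyr lee_fin => /(_ erefl) h; exfalso; lra.
Qed.

Lemma nbhs_right_itv (R : realType) (b : R) : 0 < b ->
  (0^'+ : set_system R) [set x | 0 < x < b].
Proof.
move=> b0; exists b => //= y; rewrite /ball/= sub0r normrN => yb y0.
by rewrite y0 -(gtr0_norm y0).
Qed.

(** * Box dimensions as power inequalities; Hausdorff against lower box dimension *)

Section box_dimension.
Context {R : realType} {d : nat}.
Implicit Types (E F A : set 'rV[R]_d) (s delta : R).

Definition coverable (n : nat) F delta := exists U : 'I_n -> set 'rV[R]_d,
  (forall i, (ediam (U i) <= delta%:E)%E) /\ F `<=` \bigcup_i U i.

Lemma coverable_seq (T : eqType) (t : seq T) (U : T -> set 'rV[R]_d) F delta :
  (forall q, q \in t -> (ediam (U q) <= delta%:E)%E) ->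
  (forall x, F x -> exists2 q, q \in t & U q x) -> coverable (size t) F delta.
Proof.
move=> Ud FU; exists (fun i => U (tnth (in_tuple t) i)); split=> [i|x].
  by apply: Ud; exact: mem_tnth.
move=> /FU[q qt Uq]; move: (qt); rewrite -index_mem => qi.
exists (Ordinal qi) => //=; rewrite (tnth_nth q)/= nth_index//.
Qed.

Lemma coverable_gt0 n F delta : F !=set0 -> coverable n F delta -> (0 < n)%N.
Proof. by case: n => // -[x Fx] [U [_ /(_ x Fx)[[]]]]. Qed.

Lemma covering_number_le n F delta :
  coverable n F delta -> (covering_number F delta <= n%:R%:E)%E.
Proof. by move=> cF; apply: ereal_inf_lbound; exists n. Qed.

Lemma covering_number_lt F delta (x : \bar R) : (covering_number F delta < x)%E ->
  exists2 n, coverable n F delta & (n%:R%:E < x)%E.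
Proof. by move=> /ereal_inf_lt[_ [n cF <-] nx]; exists n. Qed.

Lemma covering_number_ge (a : R) F delta :
  (forall n, coverable n F delta -> a <= n%:R) ->
  (a%:E <= covering_number F delta)%E.
Proof. by move=> aF; apply: le_ereal_inf_tmp => _ [n cF <-]; exact: aF. Qed.

Lemma box_ratio_lt F delta s : 0 < delta < 1 ->
  (lne (covering_number F delta) * ((- ln delta)^-1)%:E < s%:E)%E ->
  exists2 n, coverable n F delta & n%:R <= delta `^ (- s).
Proof.
move=> /andP[d0 d1]; have L0 : 0 < - ln delta by rewrite oppr_gt0 ln_lt0// d0.
rewrite lte_pdivrMr// -EFinM => h.
have : (covering_number F delta < (delta `^ (- s))%:E)%E.
  rewrite /powR gt_eqF// mulNr -mulrN.
  case: (covering_number F delta) h => [r| |] //=.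
    case: ifPn => [r0 _|]; first by rewrite lte_fin (le_lt_trans r0)// expR_gt0.
    by rewrite -ltNge => r0; rewrite !lte_fin -ltr_expR lnK.
  by rewrite ?ltNyr// ltNge leey.
by move=> /covering_number_lt[n nF]; rewrite lte_fin => /ltW; exists n.
Qed.

Lemma box_ratio_le F delta s n : 0 < delta < 1 -> coverable n F delta ->
  n%:R <= delta `^ (- s) ->
  (lne (covering_number F delta) * ((- ln delta)^-1)%:E <= s%:E)%E.
Proof.
move=> /andP[d0 d1] nF ns.
have L0 : 0 < - ln delta by rewrite oppr_gt0 ln_lt0// d0.
rewrite lee_pdivrMr// -EFinM.
have <- : lne (delta `^ (- s))%:E = (s * - ln delta)%:E.
  by rewrite lne_EFin ?powR_gt0// ln_powR mulNr mulrN.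
rewrite lee_lne ?in_itv/= ?leey ?andbT.
- by apply: le_trans (covering_number_le nF) _; rewrite lee_fin.
- by apply: le_ereal_inf_tmp => _ [k _ <-]; rewrite lee_fin.
- by rewrite lee_fin powR_ge0.
Qed.

Lemma lower_dimB_lt F s : (lower_dimB F < s%:E)%E -> forall e, 0 < e ->
  exists delta n, [/\ 0 < delta, delta < e, delta < 1, coverable n F delta &
    n%:R <= delta `^ (- s)].
Proof.
rewrite /lower_dimB limf_einfE => Fs e e0.
set u := (fun delta : R => _) in Fs.
have : (ereal_inf (u @` [set delta | (0 < delta < Num.min e 1)%R]) < s%:E)%E.
  apply: le_lt_trans Fs; apply: ereal_sup_ubound.
  exists [set delta | 0 < delta < Num.min e 1] => //.
  have m0 : 0 < Num.min e 1 :> R by rewrite lt_min e0/=.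
  exact: nbhs_right_itv.
move=> /ereal_inf_lt[_ [delta /= /andP[d0 +] <-]]; rewrite lt_min => /andP[de d1].
move=> /box_ratio_lt[|n nF ns]; first by rewrite d0.
by exists delta, n.
Qed.

Lemma lower_dimB_le F s : (forall e, 0 < e ->
    exists delta n, [/\ 0 < delta, delta < e, delta < 1, coverable n F delta &
      n%:R <= delta `^ (- s)]) ->
  (lower_dimB F <= s%:E)%E.
Proof.
move=> H; rewrite /lower_dimB limf_einfE; apply: ge_ereal_sup => _ [V [e /= e0 eV] <-].
have [delta [n [d0 de d1 nF ns]]] := H e e0.
apply: ge_ereal_inf; eexists.
  exists delta; last reflexivity.
  by apply: eV => //=; rewrite sub0r normrN gtr0_norm.
by apply: box_ratio_le nF ns; rewrite d0.
Qed.

Lemma upper_dimB_lt F s : (upper_dimB F < s%:E)%E -> exists2 e, 0 < e &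
  forall delta, 0 < delta < e ->
    exists2 n, coverable n F delta & n%:R <= delta `^ (- s).
Proof.
rewrite /upper_dimB limf_esupE => /ereal_inf_lt[_ [V [e /= e0 eV] <-] Vs].
exists (Num.min e 1); first by rewrite lt_min e0/=.
move=> delta /andP[d0]; rewrite lt_min => /andP[de d1].
apply: box_ratio_lt; first by rewrite d0.
apply: le_lt_trans Vs; apply: ereal_sup_ubound; exists delta => //.
by apply: eV => //=; rewrite sub0r normrN gtr0_norm.
Qed.

Lemma upper_dimB_le F s e : 0 < e -> (forall delta, 0 < delta < e ->
    exists2 n, coverable n F delta & n%:R <= delta `^ (- s)) ->
  (upper_dimB F <= s%:E)%E.
Proof.
move=> e0 H; rewrite /upper_dimB limf_esupE; apply: ge_ereal_inf; eexists.
  exists [set delta | 0 < delta < Num.min e 1]; last reflexivity.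
  have m0 : 0 < Num.min e 1 :> R by rewrite lt_min e0/=.
  exact: nbhs_right_itv.
apply: ge_ereal_sup => _ [delta /= /andP[d0 +] <-]; rewrite lt_min => /andP[de d1].
have [|n nF ns] := H delta; first by rewrite d0.
by apply: box_ratio_le nF ns; rewrite d0.
Qed.

(** A nonempty set needs at least one covering set. The sign matters because [dimH] and [dimP] only
    admit exponents [s >= 0]. *)
Lemma coverable_exponent_ge0 F n delta s : F !=set0 -> 0 < delta < 1 ->
  coverable n F delta -> n%:R <= delta `^ (- s) -> 0 <= s.
Proof.
move=> F0 /andP[d0 d1] nF ns; rewrite leNgt; apply/negP => s0.
have n1 : 1 <= n%:R :> R by rewrite ler1n; exact: coverable_gt0 nF.
have := le_trans n1 ns; rewrite leNgt => /negP; apply.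
rewrite -[ltRHS](powRr0 delta) /powR gt_eqF// ltr_expR mul0r mulNr oppr_lt0.
by rewrite nmulr_rgt0// ln_lt0// d0.
Qed.

Lemma powR_small (a e : R) : 0 < a -> 0 < e -> exists2 b : R, 0 < b &
  forall x, 0 < x -> x < b -> x `^ a < e.
Proof.
move=> a0 e0; exists (e `^ a^-1); first exact: powR_gt0.
move=> x x0 xb; have -> : e = (e `^ a^-1) `^ a.
  by rewrite -powRrM mulVf ?gt_eqF// powRr1// ltW.
by apply: gt0_ltr_powR; rewrite // nnegrE ?powR_ge0// ltW.
Qed.

(** A cover by at most [delta ^ -s] sets of diameter at most [delta] has an [(s + t)]-sum of at most
    [delta ^ t], which is arbitrarily small. *)
Lemma dimH_le_lower_dimB F : F !=set0 -> (dimH F <= lower_dimB F)%E.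
Proof.
move=> F0; apply: lee_real_above => s sF.
have s0 : 0 <= s.
  have [delta [n [d0 _ d1 nF ns]]] := lower_dimB_lt sF ltr01.
  by apply: coverable_exponent_ge0 F0 _ nF ns; rewrite d0.
apply/lee_addgt0Pr => t t0; apply: ereal_inf_lbound; exists (s + t) => //.
split; first by rewrite addr_ge0// ltW.
have pre_ge0 delta : (0 <= hausdorff_premeasure (s + t) delta F)%E.
  apply: le_ereal_inf_tmp => _ [I [U [_ _ ->]]].
  by apply: esum_ge0 => i _; exact: poweR_ge0.
apply/eqP; rewrite eq_le; apply/andP; split; last first.
  apply: le_trans (pre_ge0 1) _; apply: ereal_sup_ubound.
  by exists 1 => //=.
apply: ge_ereal_sup => _ [e /= e0 <-].
apply/lee_addgt0Pr => a a0; rewrite add0e.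
have [b b0 Hb] := powR_small t0 a0.
have [|delta [n [d0 + d1 [U [Ud FU]] ns]]] := lower_dimB_lt sF (e := Num.min e b).
  by rewrite lt_min e0.
rewrite lt_min => /andP[de db].
pose V i := if insub i is Some j then U j else set0.
have VU (j : 'I_n) : V j = U j by rewrite /V insubT//= => ?; congr U; exact: val_inj.
apply: (@le_trans _ _ (\esum_(i in `I_n) (ediam (V i) `^ (s + t)))%E).
  apply: ereal_inf_lbound; exists `I_n, V; split=> // [i /= ilt|x /FU[j _ xj]].
    by rewrite (VU (Ordinal ilt)) (le_trans (Ud _))// lee_fin ltW.
  by exists j; rewrite ?VU//=.
rewrite esum_fset//; last by move=> i _; exact: poweR_ge0.
apply: (@le_trans _ _ (\sum_(i \in `I_n) (delta `^ (s + t))%:E)%E).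
  apply: lee_fsum => // i /= ilt.
  rewrite -poweR_EFin; apply: gt0_ler_poweR.
  - by rewrite addr_ge0// ltW.
  - by rewrite in_itv/= ediam_ge0 leey.
  - by rewrite in_itv/= lee_fin ltW//= leey.
  - by rewrite (VU (Ordinal ilt)).
rewrite -fsbig_ord sumEFin lee_fin sumr_const card_ord -mulr_natl.
apply: (@le_trans _ _ (delta `^ (- s) * delta `^ (s + t))).
  by rewrite ler_wpM2r ?powR_ge0.
rewrite -powRD; last by apply/implyP => _; rewrite gt_eqF.
by rewrite addKr ltW// Hb.
Qed.

End box_dimension.

Lemma sum_geometric_le (R : realFieldType) (x : R) K B : 0 <= x < 1 ->
  \sum_(K <= k < B) x ^+ k <= x ^+ K / (1 - x).
Proof.
move=> /andP[x0 x1]; have y0 : 0 < 1 - x by rewrite subr_gt0.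
have [BK|/ltnW KB] := leqP B K.
  by rewrite big_geq// divr_ge0 ?exprn_ge0// ltW.
rewrite ler_pdivlMr// mulr_suml (eq_bigr (fun k => - x ^+ k.+1 - - x ^+ k)).
  by rewrite telescope_sumr// opprK addrC lerBlDr lerDl exprn_ge0.
by move=> k _; rewrite exprSr; ring.
Qed.

(** * Packing against upper box dimension *)

Section packing.
Context {R : realType} {d : nat}.
Implicit Types (E F : set 'rV[R]_d) (s delta : R).

(** Two centres in the same covering set are at distance at most [delta], less than the radii, so
    their balls would meet. Distinct balls thus occupy distinct covering sets. *)
Lemma packing_count F n delta (I : set nat) (c : nat -> 'rV[R]_d)
    (rho : nat -> R) (Z : seq nat) : coverable n F delta ->
  (forall i, I i -> F (c i)) -> trivIset I (fun i => cball (c i) (rho i)) ->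
  uniq Z -> (forall i, i \in Z -> I i /\ delta < rho i) -> (size Z <= n)%N.
Proof.
move=> nF Fc tI uZ ZI; have [->//|] := eqVneq Z [::].
case: Z uZ ZI => // i0 Z; move: (i0 :: Z) (mem_head i0 Z) => {}Z i0Z uZ ZI _.
have n0 : (0 < n)%N.
  by apply: coverable_gt0 nF; exists (c i0); apply: Fc; have [] := ZI _ i0Z.
have [U [Ud FU]] := nF.
have /choice[j Hj] i : exists j : 'I_n, I i -> U j (c i).
  have [/Fc/FU[j _ ?]|nI] := pselect (I i); first by exists j.
  by exists (Ordinal n0).
rewrite -[n in leqRHS]card_ord cardE -(size_map j); apply: uniq_leq_size.
  rewrite map_inj_in_uniq// => i i' iZ iZ' jj'.
  have [Ii ri] := ZI _ iZ; have [Ii' ri'] := ZI _ iZ'.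
  have r0 : 0 <= delta.
    by rewrite -lee_fin; exact: le_trans (ediam_ge0 _) (Ud (j i)).
  apply: tI => //; exists (c i'); split; rewrite /cball/= ?eudistxx.
    apply: le_trans (ltW ri); rewrite -lee_fin; apply: le_trans (Ud (j i)).
    by apply: eudist_le_ediam; [|rewrite jj']; apply: Hj.
  exact: ltW (le_lt_trans r0 ri').
by move=> x _; rewrite mem_enum.
Qed.

Let h k : R := 2^-1 ^+ k.

Let h_gt0 k : 0 < h k. Proof. by rewrite exprn_gt0// invr_gt0. Qed.

Let hS k : h k.+1 = h k / 2. Proof. by rewrite /h exprSr. Qed.

Let h_le k m : (k <= m)%N -> h m <= h k.
Proof. by move=> km; rewrite ler_wiXn2l// ?invr_ge0// invf_le1// ler1n. Qed.

Let h_small (e : R) : 0 < e -> exists K, forall k, (K <= k)%N -> h k < e.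
Proof.
move=> e0; have h2 : `|2^-1 : R| < 1 by rewrite ger0_norm ?invf_lt1 ?ltr1n.
have /cvgr0Pnorm_lt/(_ e e0)[K _ HK] := cvg_expr h2.
by exists K => k /HK; rewrite ger0_norm// exprn_ge0.
Qed.

Let dyadic (r : R) K : 0 < r <= h K ->
  exists k, [/\ (K <= k)%N, h k.+1 < r & r <= h k].
Proof.
move=> /andP[r0 rK]; have [K0 HK0] := h_small r0.
have ex : exists k, h k.+1 < r by exists K0; apply: HK0.
case: (ex_minnP ex) => k hk mink; exists k; split=> //.
  rewrite leqNgt; apply/negP => kK.
  by have := lt_le_trans hk (le_trans rK (h_le kK)); rewrite ltxx.
case: k hk mink => [|k] hk mink; first exact: le_trans rK (h_le (leq0n K)).
by rewrite leNgt; apply/negP => /mink; rewrite ltnn.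
Qed.

Lemma packing_premeasure_ge0 s F : (0 <= packing_premeasure s F)%E.
Proof.
apply: le_ereal_inf_tmp => _ [delta /= d0 <-]; apply: ereal_sup_ubound.
by exists set0, (fun=> 0), (fun=> 0); split=> //; rewrite esum_set0.
Qed.

Lemma packing_premeasure_set0 s : packing_premeasure s (set0 : set 'rV[R]_d) = 0%E.
Proof.
apply/eqP; rewrite eq_le packing_premeasure_ge0 andbT; apply: ge_ereal_inf.
eexists; first by exists 1 => /=.
apply: ge_ereal_sup => _ [I [c [rho [Ic _ _ ->]]]].
suff -> : I = set0 by rewrite esum_set0.
by apply/seteqP; split=> // i /Ic.
Qed.

(* Grouping the balls of a packing by the dyadic size of their radii, each
   group has at most as many balls as a cover at that scale has sets. *)
Lemma packing_premeasure_eq0 F s t e : 0 <= s -> 0 < t -> 0 < e ->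
  (forall delta, 0 < delta < e ->
    exists2 n, coverable n F delta & n%:R <= delta `^ (- s)) ->
  packing_premeasure (s + t) F = 0%E.
Proof.
move=> s0 t0 e0 He; apply/eqP; rewrite eq_le packing_premeasure_ge0 andbT.
apply/lee_addgt0Pr => a a0; rewrite add0e.
(* The balls of group [k] contribute at most [h k.+1 ^ -s * (2 * h k) ^ (s + t) = A * x ^ k]: one
   factor of [A] comes from halving the scale, the other from diameters being twice the radii. *)
pose x : R := 2^-1 `^ t; pose A : R := 2 `^ s * 2 `^ (s + t).
have x01 : 0 <= x < 1.
  rewrite powR_ge0/=; have -> : 1 = 1 `^ t :> R by rewrite powR1.
  by apply: gt0_ltr_powR; rewrite // ?nnegrE ?invf_lt1 ?ltr1n.
have A0 : 0 < A by rewrite mulr_gt0 ?powR_gt0.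
have [y0 y1] : 0 < x /\ 0 < 1 - x.
  by split; [exact: powR_gt0|rewrite subr_gt0; case/andP: x01].
have [K1 HK1] := h_small e0.
have [K2 HK2] : exists K, forall k, (K <= k)%N -> x ^+ k < a * (1 - x) / A.
  have ax : 0 < a * (1 - x) / A by rewrite divr_gt0// mulr_gt0.
  have x1 : `|x| < 1 by rewrite gtr0_norm//; case/andP: x01.
  have /cvgr0Pnorm_lt/(_ _ ax)[K _ HK] := cvg_expr x1.
  by exists K => k /HK; rewrite ger0_norm// exprn_ge0// ltW.
pose K := maxn K1 K2.
apply: ge_ereal_inf; eexists; first by exists (h K) => /=.
apply: ge_ereal_sup => _ [I [c [rho [Ic Irho tI ->]]]].
apply: ge_ereal_sup => _ [X [finX XI] <-].
rewrite fsbig_finite// sumEFin lee_fin.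
set Y : seq nat := finmap.enum_fset (fset_set X).
have uY : uniq Y by exact: finmap.fset_uniq.
have YI i : i \in Y -> I i.
  by move=> iY; apply/XI/set_mem; rewrite -(in_fset_set finX).
have /choice[kap Hkap] i : exists k, i \in Y ->
    [/\ (K <= k)%N, h k.+1 < rho i & rho i <= h k].
  case: (boolP (i \in Y)) => [/YI/Irho/dyadic[k Hk]|_]; first by exists k.
  by exists 0%N.
pose B := (\max_(i <- Y) kap i).+1.
have kapB i : i \in Y -> (K <= kap i < B)%N.
  by move=> iY; have [-> _ _] := Hkap _ iY; rewrite ltnS leq_bigmax_seq.
apply: (@le_trans _ _ (\sum_(i <- Y) \sum_(K <= k < B | kap i == k)
    (2 * h k) `^ (s + t))).
  rewrite big_seq [leRHS]big_seq; apply: ler_sum => i iY.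
  rewrite big_mkcond/= (bigD1_seq (kap i)) ?iota_uniq ?mem_index_iota ?kapB//= eqxx.
  rewrite ler_wpDr ?sumr_ge0// => [k _|]; first by case: ifP => // _; exact: powR_ge0.
  have [_ r1 r2] := Hkap _ iY.
  have r0 : 0 < rho i by apply: lt_trans r1.
  apply: ge0_ler_powR; rewrite ?ler_pM2l//.
  - by rewrite addr_ge0// ltW.
  - by rewrite nnegrE mulr_ge0// ltW.
  - by rewrite nnegrE mulr_ge0// ltW.
rewrite (exchange_big_dep xpredT)//=.
apply: (@le_trans _ _ (\sum_(K <= k < B) A * x ^+ k)); last first.
  rewrite -mulr_sumr; apply: (@le_trans _ _ (A * (x ^+ K / (1 - x)))).
    by rewrite ler_pM2l// sum_geometric_le.
  rewrite mulrA ler_pdivrMr// mulrC -ler_pdivlMr//.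
  by apply/ltW/HK2; rewrite leq_maxr.
rewrite big_nat [leRHS]big_nat; apply: ler_sum => k /andP[Kk _].
(* The cover is taken at scale [h k.+1], strictly below every radius of group [k], as
   [packing_count] requires. *)
have hke : 0 < h k.+1 < e.
  by rewrite h_gt0 HK1//; lia.
have [n nF ns] := He _ hke.
rewrite big_const_seq iter_addr_0.
have cn : (count (fun i => kap i == k) Y <= n)%N.
  rewrite -size_filter; apply: (packing_count nF Ic tI).
    by rewrite filter_uniq.
  move=> i; rewrite mem_filter => /andP[/eqP kk iY]; split; first exact: YI.
  by have [_] := Hkap _ iY; rewrite kk.
apply: (@le_trans _ _ (h k.+1 `^ (- s) * (2 * h k) `^ (s + t))).
  rewrite -[leLHS]mulr_natl ler_wpM2r ?powR_ge0//.
  by apply: le_trans ns; rewrite ler_nat.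
have hk0 : 0 <= h k := ltW (h_gt0 k).
rewrite hS !powRM ?invr_ge0// /A.
have -> : 2^-1 `^ (- s) = 2 `^ s :> R by rewrite -powR_inv1// -powRrM mulN1r opprK.
have -> : x ^+ k = h k `^ t.
  by rewrite /x /h -!powR_mulrn ?powR_ge0 ?invr_ge0// powRAC.
have -> : h k `^ (s + t) = h k `^ s * h k `^ t.
  by rewrite powRD//; apply/implyP => _; rewrite gt_eqF.
rewrite powRN le_eqVlt; apply/orP; left; apply/eqP.
have hs : h k `^ s != 0 by rewrite gt_eqF ?powR_gt0.
by field.
Qed.

Lemma dimP_le_upper_dimB F : F !=set0 -> (dimP F <= upper_dimB F)%E.
Proof.
move=> F0; apply: lee_real_above => s /upper_dimB_lt[e e0 He].
have s0 : 0 <= s.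
  pose m := Num.min e 1; have m0 : 0 < m by rewrite lt_min e0/=.
  have [m1 m2] : m <= e /\ m <= 1 by rewrite !ge_min !lexx orbT.
  have [|n nF ns] := He (m / 2); first by apply/andP; split; lra.
  by apply: coverable_exponent_ge0 F0 _ nF ns; apply/andP; split; lra.
apply/lee_addgt0Pr => t t0; apply: ereal_inf_lbound; exists (s + t) => //.
split; first by rewrite addr_ge0// ltW.
have pre0 := packing_premeasure_eq0 s0 t0 e0 He.
pose G i : set 'rV[R]_d := if (i == 0)%N then F else set0.
apply/eqP; rewrite eq_le; apply/andP; split.
  apply: ge_ereal_inf; eexists.
    exists G; last reflexivity.
    by move=> x Fx; exists 0%N.
  rewrite eseries0// => -[|i] _ _ //=; exact: packing_premeasure_set0.
apply: le_ereal_inf_tmp => _ [G' _ <-]; apply: nneseries_ge0 => i _ _.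
exact: packing_premeasure_ge0.
Qed.

End packing.

(** * Compactness of tree sets *)

Section tree_topology.
Context {R : realType} {d : nat} {M N : nat -> nat}.
Hypothesis d_gt0 : (0 < d)%N.
Hypothesis M_ge2 : forall k, (1 <= k)%N -> (2 <= M k)%N.
Hypothesis N_gt0 : forall k, (0 < k)%N -> (0 < N k)%N.
Local Notation W := {ffun 'I_d -> nat}.
Local Notation cube := (@cube R d M).
Local Notation tree_set := (@tree_set R d M).
Local Notation cube_meets := (@cube_meets R d M).
Implicit Types (q : W) (x y : 'rV[R]_d).
Variable T : nat -> seq W.
Hypothesis treeT : tree M N T.

(* Koenig's lemma: otherwise there is a branch of cubes none of which is good. *)
Lemma tree_compact (good : nat -> W -> Prop) :
  (forall n j q, good n (ancestor M n j q) -> good (n + j)%N q) ->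
  (forall x, tree_set T x ->
    exists n, forall q, q \in T n -> cube n q x -> good n q) ->
  exists n, forall q, q \in T n -> good n q.
Proof.
move=> mono Hgood; apply: contrapT => /forallNP nogood.
(* Bad cubes have descendants that are not good at every later level; this is what passes to some
   child. *)
pose bad n q := q \in T n /\ forall j, exists q', [/\ q' \in T (n + j)%N,
  ancestor M n j q' = q & ~ good (n + j)%N q'].
have bad0 : bad 0%N root_index.
  have [T0 _ _ _] := treeT; split; first by rewrite T0 mem_head.
  move=> j; have /existsNP[q /not_implyP[qT qg]] := nogood j.
  exists q; split=> //.
  by have := @ancestor_tree _ _ _ _ treeT 0%N j q qT; rewrite T0 inE => /eqP.
have badS n q : exists q', bad n q -> bad n.+1 q' /\ parent M n q' = q.
  have [bq|] := pselect (bad n q); last by exists q.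
  apply: contrapT => /forallNP H.
  have /choice[j Hj] q1 : exists j, q1 \in T n.+1 -> parent M n q1 = q ->
      forall q', q' \in T (n.+1 + j)%N -> ancestor M n.+1 j q' = q1 ->
        good (n.+1 + j)%N q'.
    apply: contrapT => /forallNP Hq1; apply: (H q1) => _.
    have /not_implyP[q1T /not_implyP[pq1 _]] := Hq1 0%N.
    split=> //; split=> // j; have /not_implyP[_ /not_implyP[_]] := Hq1 j.
    by move=> /existsNP[q' /not_implyP[q'T /not_implyP[? ?]]]; exists q'.
  (* There are finitely many children. If none were bad, by monotonicity all descendants of [q]
     would be good from the largest of their levels on. *)
  pose J := (\max_(q1 <- T n.+1) j q1)%N.
  have [_ /(_ J.+1)[q' [q'T qq' nq']]] := bq; apply: nq'.
  rewrite addnS -addSn in q'T *.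
  pose q1 := ancestor M n.+1 J q'.
  have q1T : q1 \in T n.+1 by exact: (ancestor_tree treeT q'T).
  have pq1 : parent M n q1 = q.
    rewrite -qq' -addn1 addnC ancestorD/= addn0 /q1.
    by rewrite addn1.
  have jJ : (j q1 <= J)%N by exact: (@leq_bigmax_seq _ _ xpredT j q1 q1T).
  have e : (n.+1 + j q1 + (J - j q1) = n.+1 + J)%N by rewrite -addnA subnKC.
  rewrite -e; apply: mono; apply: (Hj q1) => //.
    by apply: (ancestor_tree treeT); rewrite e.
  by rewrite -ancestorD subnKC.
have /choice[f Hf] (nq : nat * W) : exists q',
    bad nq.1 nq.2 -> bad nq.1.+1 q' /\ parent M nq.1 q' = nq.2 by exact: badS.
pose c := fix c n := if n is n'.+1 then f (n', c n') else root_index.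
have cbad n : bad n (c n) by elim: n => //= n /(Hf (n, c n))[].
have [x xT xc] : exists2 x, tree_set T x & forall i, cube i (c i) x.
  apply: (@nested_point _ _ _ _ M_ge2 T id c treeT) => [//|i|i y].
    by have [] := cbad i.
  by move=> /(cube_parent M_ge2); have [_ ->] := Hf (i, c i) (cbad i).
have [n Hn] := Hgood x xT.
have [cT /(_ 0%N)[q [_ /= -> ng]]] := cbad n.
by apply: ng; rewrite addn0; exact: Hn.
Qed.

(** Otherwise every cube contains a smaller one missing [F i]. Shrinking in this way for
    [i = 0, 1, ...] leads to a point of the set outside all [F i]. The conclusion says that some
    [F i] is dense in the part of the set below [q]. *)
Lemma tree_baire (F : nat -> set 'rV[R]_d) : tree_set T `<=` \bigcup_i F i ->
  exists i k q, q \in T k /\ forall j q', q' \in T (k + j)%N ->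
    ancestor M k j q' = q -> exists2 x, F i x & cube (k + j)%N q' x.
Proof.
move=> TF; apply: contrapT => H.
have /choice[f Hf] (ikq : nat * (nat * W)) : exists kq,
    ikq.2.2 \in T ikq.2.1 -> [/\ (ikq.2.1 < kq.1)%N, kq.2 \in T kq.1,
      cube kq.1 kq.2 `<=` cube ikq.2.1 ikq.2.2 &
      forall x, F ikq.1 x -> ~ cube kq.1 kq.2 x].
  case: ikq => i [k q] /=; have [qT|] := boolP (q \in T k); last by exists (k, q).
  apply: contrapT => /forallNP nex; apply: H; exists i, k, q; split=> // j q' q'T qq'.
  apply: contrapT => /forall2NP nF.
  (* One level further down, since [j] may be 0 and [nested_point] wants strictly increasing
     levels. *)
  have [q2 q2T q2q'] := has_descendant treeT 1%N N_gt0 q'T.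
  have sub : cube (k + j + 1)%N q2 `<=` cube (k + j)%N q'.
    by rewrite -q2q'; exact: cube_ancestor.
  apply: (nex ((k + j + 1)%N, q2)) => _; split=> //=.
  - by rewrite addn1 ltnS leq_addr.
  - by apply: subset_trans sub _; rewrite -qq'; exact: cube_ancestor.
  - by move=> x Fx /sub; have [] := nF x.
pose st := fix st i := if i is i'.+1 then f (i', st i') else (0%N, root_index).
have stT i : (st i).2 \in T (st i).1.
  elim: i => [|i /(Hf (i, st i))[]//].
  by have [-> _ _ _] := treeT; exact: mem_head.
have [x xT xst] : exists2 x, tree_set T x & forall i, cube (st i).1 (st i).2 x.
  apply: (@nested_point _ _ _ _ M_ge2 T (fun i => (st i).1) (fun i => (st i).2) treeT);
    move=> i //; by have [] := Hf (i, st i) (stT i).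
have [i _ Fx] := TF x xT.
by have [_ _ _ /(_ x Fx)] := Hf (i, st i) (stT i); apply; exact: (xst i.+1).
Qed.

(* At the scale [mesh k.+1 <= rho < mesh k], a set of diameter [rho] meets at most
   [min ((5 rho / mesh k.+1)^d, 5^d N k.+1)] cubes of level [k.+1]. *)
Lemma count_meets_tree s n0 (rho : R) : 0 <= s <= d%:R ->
  (forall n, (n0 <= n)%N ->
    (mesh R M n.+1 * (N n.+1)%:R `^ d%:R^-1) `^ (- s) <= (seq_prod N n)%:R) ->
  0 < rho < mesh R M n0 ->
  exists k, forall n U, (k <= n)%N ->
    (forall x y, U x -> U y -> eudist x y <= rho) ->
    (count (cube_meets n U) (T n))%:R <= 5 ^+ d * rho `^ s * (seq_prod N n)%:R.
Proof.
move=> /andP[s0 sd] Hs /andP[rho0 rhon0].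
have [_ uT _ _] := treeT.
have mesh0' n : 0 < mesh R M n by exact: mesh_gt0.
have rho_n0 : 0 < rho < mesh R M n0 by rewrite rho0.
have [k [n0k krho rhok]] := mesh_bracket M_ge2 rho_n0.
exists k.+1 => n U kn Urho.
have P0 m : 0 < (seq_prod N m)%:R :> R by rewrite ltr0n seq_prod_gt0.
set c1 : R := (count (cube_meets k.+1 U) (T k.+1))%:R.
(* A cube of level [n] meeting [U] descends from a cube of level [k.+1] meeting [U], so the share of
   cubes met can only decrease. *)
have up : (count (cube_meets n U) (T n))%:R * (seq_prod N k.+1)%:R <=
    c1 * (seq_prod N n)%:R.
  rewrite /c1 -!natrM ler_nat.
  have := count_descendants treeT k.+1 (n - k.+1)%N (cube_meets k.+1 U).
  rewrite subnKC// => <-; rewrite leq_mul2r; apply/orP; right.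
  apply: sub_count => q /= /cube_meetsP[x Ux xq]; apply/cube_meetsP; exists x => //.
  by apply: (cube_ancestor M_ge2); rewrite subnKC.
have Nk0 : 0 < (N k.+1)%:R :> R by rewrite ltr0n N_gt0.
set r := mesh R M k.+1 in krho *.
have b1 : c1 <= (5 * rho / r) ^+ d by exact: count_meets.
have b2 : c1 <= 5 ^+ d * (N k.+1)%:R.
  have : c1 <= (count (cube_meets k U) (T k))%:R * (N k.+1)%:R.
    rewrite /c1 -natrM -(count_children treeT k (cube_meets k U)) ler_nat.
    apply: sub_count => q /= /cube_meetsP[x Ux xq]; apply/cube_meetsP; exists x => //.
    exact: cube_parent xq.
  move=> /le_trans; apply; rewrite ler_pM2r//.
  have := @count_meets _ _ _ M_ge2 k U (T k) (mesh R M k) (uT k).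
  rewrite mulfK ?gt_eqF//; apply=> // x y Ux Uy.
  exact: le_trans (Urho _ _ Ux Uy) (ltW rhok).
pose nu : R := (N k.+1)%:R `^ d%:R^-1.
pose sigma := r * nu.
have nu0 : 0 < nu by exact: powR_gt0.
have r0 : 0 < r by exact: mesh0'.
have sigma0 : 0 < sigma by apply: mulr_gt0.
have Pk : 1 <= (seq_prod N k)%:R * sigma `^ s.
  have := Hs _ n0k; rewrite -/r -/nu -/sigma powRN.
  by rewrite -[X in X <= _ -> _]mul1r ler_pdivrMr ?powR_gt0.
suff b : c1 <= 5 ^+ d * rho `^ s * (seq_prod N k.+1)%:R.
  rewrite -(ler_pM2r (P0 k.+1)); apply: le_trans up _.
  by rewrite mulrAC ler_pM2r.
rewrite seq_prodS natrM -mulrA.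
(* The two bounds cross at [sigma]. Below it, [b1] reads [5 ^ d * N k.+1 * (rho / sigma) ^ d], where
   the exponent [d] may be lowered to [s]; above it, [b2] suffices because [sigma ^ s <= rho ^ s].
   [Pk] then trades [sigma ^ -s] for the number of cubes of level [k]. *)
have [rs|sr] := leP rho sigma.
  apply: le_trans b1 _; rewrite -mulrA exprMn ler_pM2l ?exprn_gt0//.
  have nud : nu ^+ d = (N k.+1)%:R.
    by rewrite -powR_mulrn ?(ltW nu0)// -powRrM mulVf ?pnatr_eq0 -?lt0n ?powRr1.
  have -> : rho / r = rho / sigma * nu.
    by rewrite /sigma invfM mulrA mulfVK ?gt_eqF.
  rewrite exprMn nud mulrA ler_pM2r//.
  apply: (@le_trans _ _ ((rho / sigma) `^ s)).
    rewrite -powR_mulrn ?divr_ge0 ?(ltW rho0) ?(ltW sigma0)//.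
    apply: ger_powR => //; rewrite divr_gt0//= ler_pdivrMr ?mul1r//.
  rewrite powRM ?invr_ge0 ?(ltW rho0) ?(ltW sigma0)//.
  rewrite ler_pM2l ?powR_gt0// -powR_inv1 ?(ltW sigma0)// -powRrM mulN1r powRN.
  by rewrite -[leLHS]mul1r ler_pdivrMr ?powR_gt0.
apply: le_trans b2 _; rewrite ler_pM2l ?exprn_gt0// mulrA.
rewrite -[leLHS]mul1r ler_pM2r//; apply: le_trans Pk _.
rewrite mulrC ler_pM2r//; apply: ge0_ler_powR => //.
- by rewrite nnegrE ltW.
- by rewrite nnegrE ltW.
- exact: ltW.
Qed.

End tree_topology.

(** * The scales attached to t_star and s_two *)

Section limits_inf_sup.
Context {R : realType}.
Implicit Types (u : nat -> \bar R) (x : \bar R).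

Lemma limn_einf_lt u x : (limn_einf u < x)%E ->
  forall k, exists2 n, (k <= n)%N & (u n < x)%E.
Proof.
rewrite /limn_einf -/(limf_einf u \oo) limf_einfE => ux k.
have : (ereal_inf (u @` [set n | (k <= n)%N]) < x)%E.
  apply: le_lt_trans ux; apply: ereal_sup_ubound; exists [set n | (k <= n)%N] => //.
  by exists k.
by move=> /ereal_inf_lt[_ [n /= kn <-] unx]; exists n.
Qed.

Lemma limn_einf_gt u x : (x < limn_einf u)%E ->
  exists n0, forall n, (n0 <= n)%N -> (x < u n)%E.
Proof.
rewrite /limn_einf -/(limf_einf u \oo) limf_einfE.
move=> /ereal_sup_gt[_ [V [n0 _ n0V] <-] xV]; exists n0 => n n0n.
by apply: lt_le_trans xV _; apply: ereal_inf_lbound; exists n => //; exact: n0V.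
Qed.

Lemma limn_esup_gt u x : (x < limn_esup u)%E ->
  forall k, exists2 n, (k <= n)%N & (x < u n)%E.
Proof.
rewrite /limn_esup limf_esupE => xu k.
have : (x < ereal_sup (u @` [set n | (k <= n)%N]))%E.
  apply: lt_le_trans xu _; apply: ereal_inf_lbound.
  by exists [set n | (k <= n)%N] => //; exists k.
by move=> /ereal_sup_gt[_ [n /= kn <-] unx]; exists n.
Qed.

Lemma limn_esup_lt u x : (limn_esup u < x)%E ->
  exists n0, forall n, (n0 <= n)%N -> (u n < x)%E.
Proof.
rewrite /limn_esup limf_esupE.
move=> /ereal_inf_lt[_ [V [n0 _ n0V] <-] xV]; exists n0 => n n0n.
by apply: le_lt_trans xV; apply: ereal_sup_ubound; exists n => //; exact: n0V.
Qed.

Lemma log_ratio_le (p x s : R) : 0 < p -> 0 < x < 1 ->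
  (ln p / - ln x <= s) = (p <= x `^ (- s)).
Proof.
move=> p0 /andP[x0 x1].
rewrite ler_pdivrMr ?oppr_gt0 ?ln_lt0 ?x0// -[RHS]ler_ln ?posrE ?powR_gt0//.
by rewrite ln_powR mulNr mulrN.
Qed.

Lemma log_ratio_ge (p x s : R) : 0 < p -> 0 < x < 1 ->
  (s <= ln p / - ln x) = (x `^ (- s) <= p).
Proof.
move=> p0 /andP[x0 x1].
rewrite ler_pdivlMr ?oppr_gt0 ?ln_lt0 ?x0// -[RHS]ler_ln ?posrE ?powR_gt0//.
by rewrite ln_powR mulNr mulrN.
Qed.

End limits_inf_sup.

Section scales.
Context {R : realType} {d : nat} {M N : nat -> nat}.
Hypothesis d_gt0 : (0 < d)%N.
Hypothesis M_ge2 : forall k, (1 <= k)%N -> (2 <= M k)%N.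
Hypothesis N_bounds : forall k, (1 <= k)%N -> (1 <= N k <= M k ^ d)%N.
Local Notation mesh := (mesh R M).
Local Notation P n := ((seq_prod N n)%:R : R).
Local Notation t_star := (t_star R d M N).
Local Notation s_two := (s_two R d M N).

Let N_gt0 k : (0 < k)%N -> (0 < N k)%N.
Proof. by move=> /N_bounds/andP[]. Qed.

Let mesh_gt0 n : 0 < mesh n. Proof. exact: mesh_gt0. Qed.

Lemma prodN_gt0 n : 0 < P n. Proof. by rewrite ltr0n seq_prod_gt0. Qed.

Lemma prodN_ge1 n : 1 <= P n. Proof. by rewrite ler1n seq_prod_gt0. Qed.

Lemma prodN_le_mesh n : P n <= mesh n `^ (- d%:R).
Proof.
rewrite powRN powR_mulrn ?(ltW (mesh_gt0 n))// /Defs.mesh exprVn invrK -natrX ler_nat.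
elim: n => [|n IH]; first by rewrite !seq_prod0 exp1n.
rewrite !seq_prodS expnMn leq_mul//.
by have /andP[] := N_bounds (ltn0Sn n).
Qed.

(* [nu n] is the side, in cubes of level [n.+1], of a cubical block of [N n.+1]
   cubes; such a block has side [sigma n], while [N n.+1] cubes evenly spread in a
   cube of level [n] are about [tau n] apart. *)
Definition nu (n : nat) : R := (N n.+1)%:R `^ d%:R^-1.
Definition sigma (n : nat) : R := mesh n.+1 * nu n.
Definition tau (n : nat) : R := mesh n / nu n.

Lemma nu_gt0 n : 0 < nu n.
Proof. by rewrite powR_gt0// ltr0n N_gt0. Qed.

Lemma nuX n : nu n ^+ d = (N n.+1)%:R.
Proof.
by rewrite -powR_mulrn ?(ltW (nu_gt0 n))// -powRrM mulVf ?pnatr_eq0 -?lt0n ?powRr1.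
Qed.

Lemma nat_le_nu n K : (K ^ d <= N n.+1)%N -> K%:R <= nu n.
Proof.
move=> KN; rewrite -(@ler_pXn2r _ d)// ?nnegrE ?ler0n ?(ltW (nu_gt0 n))//.
by rewrite nuX -natrX ler_nat.
Qed.

Lemma nu_le_nat n K : (N n.+1 <= K ^ d)%N -> nu n <= K%:R.
Proof.
move=> KN; rewrite -(@ler_pXn2r _ d)// ?nnegrE ?ler0n ?(ltW (nu_gt0 n))//.
by rewrite nuX -natrX ler_nat.
Qed.

Lemma nu_ge1 n : 1 <= nu n.
Proof. by apply: (@nat_le_nu _ 1); rewrite exp1n N_gt0. Qed.

Lemma sigma_gt0 n : 0 < sigma n.
Proof. by rewrite mulr_gt0// nu_gt0. Qed.

Lemma tau_gt0 n : 0 < tau n.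
Proof. by rewrite divr_gt0// nu_gt0. Qed.

Lemma sigma_le_mesh n : sigma n <= mesh n.
Proof.
rewrite /sigma (meshS M_ge2 n) mulrC ler_pM2r//; apply: nu_le_nat.
by have /andP[] := N_bounds (ltn0Sn n).
Qed.

Lemma tau_le_mesh n : tau n <= mesh n.
Proof. by rewrite ler_pdivrMr ?nu_gt0// ler_peMr ?nu_ge1// ltW. Qed.

Lemma mesh_lt1 n : (0 < n)%N -> mesh n < 1.
Proof. by case: n => // n _; apply: lt_le_trans (mesh_lt M_ge2 n) (mesh_le1 M_ge2 n). Qed.

Lemma sigma_lt1 n : (0 < n)%N -> 0 < sigma n < 1.
Proof.
by move=> /mesh_lt1 h; rewrite sigma_gt0/=; apply: le_lt_trans (sigma_le_mesh n) h.
Qed.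

Lemma tau_lt1 n : (0 < n)%N -> 0 < tau n < 1.
Proof.
by move=> /mesh_lt1 h; rewrite tau_gt0/=; apply: le_lt_trans (tau_le_mesh n) h.
Qed.

Lemma t_starE : t_star = limn_einf (fun n => (ln (P n) / - ln (sigma n))%:E).
Proof.
congr limn_einf; apply/funext => n; congr ((_ / _)%:E).
by rewrite lnM ?posrE ?nu_gt0// ln_powR opprD.
Qed.

Lemma s_twoE : s_two = limn_esup (fun n => (ln (P n.+1) / - ln (tau n))%:E).
Proof.
congr limn_esup; apply/funext => n; congr ((_ / _)%:E).
by rewrite ln_div ?posrE ?nu_gt0// ln_powR opprB addrC.
Qed.

Lemma t_star_ge0 : (0 <= t_star)%E.
Proof.
rewrite leNgt; apply/negP; rewrite t_starE => /limn_einf_lt/(_ 1%N)[n n1].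
rewrite lte_fin ltNge => /negP; apply.
rewrite log_ratio_ge ?prodN_gt0 ?sigma_lt1//.
by rewrite oppr0 powRr0 prodN_ge1.
Qed.

Lemma t_star_le : (t_star <= d%:R%:E)%E.
Proof.
rewrite leNgt; apply/negP; rewrite t_starE => /limn_einf_gt[n0 /(_ n0.+1 (leqnSn _))].
rewrite lte_fin ltNge => /negP; apply.
rewrite log_ratio_le ?prodN_gt0 ?sigma_lt1//; apply: le_trans (prodN_le_mesh _) _.
rewrite !powRN lef_pV2 ?posrE ?powR_gt0 ?sigma_gt0//.
have s0 m := ltW (sigma_gt0 m); have m0 m := ltW (mesh_gt0 m).
by rewrite !powR_mulrn// lerXn2r ?nnegrE ?sigma_le_mesh.
Qed.

Lemma s_two_le : (s_two <= d%:R%:E)%E.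
Proof.
rewrite leNgt; apply/negP; rewrite s_twoE => /limn_esup_gt/(_ 1%N)[n n1].
rewrite lte_fin ltNge => /negP; apply.
rewrite log_ratio_le ?prodN_gt0 ?tau_lt1// seq_prodS natrM.
rewrite powRN powR_mulrn ?(ltW (tau_gt0 n))// -exprVn invf_div exprMn nuX mulrC.
rewrite ler_pM2l ?ltr0n ?N_gt0//; apply: le_trans (prodN_le_mesh n) _.
by rewrite powRN powR_mulrn ?(ltW (mesh_gt0 n))// (exprVn (mesh n)).
Qed.

Lemma t_star_gt s : (s%:E < t_star)%E ->
  exists n0, forall n, (n0 <= n)%N -> sigma n `^ (- s) <= P n.
Proof.
rewrite t_starE => /limn_einf_gt[n0 Hn0]; exists n0.+1 => n n0n.
rewrite -log_ratio_ge ?prodN_gt0 ?sigma_lt1//; last exact: leq_trans n0n.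
by have := Hn0 n (ltnW n0n); rewrite lte_fin => /ltW.
Qed.

Lemma s_two_lt s : (s_two < s%:E)%E ->
  exists n0, forall n, (n0 <= n)%N -> P n.+1 <= tau n `^ (- s).
Proof.
rewrite s_twoE => /limn_esup_lt[n0 Hn0]; exists n0.+1 => n n0n.
rewrite -log_ratio_le ?prodN_gt0 ?tau_lt1//; last exact: leq_trans n0n.
by have := Hn0 n (ltnW n0n); rewrite lte_fin => /ltW.
Qed.

(* Levels at which the lower (resp. upper) limit is attained up to [1 / m.+1]. *)
Definition t_star_level (m n : nat) : Prop := (m < n)%N /\
  ((ln (P n) / - ln (sigma n))%:E < t_star + (m.+1%:R^-1)%:E)%E.

Definition s_two_level (m n : nat) : Prop := (m < n)%N /\
  (s_two - (m.+1%:R^-1)%:E < (ln (P n.+1) / - ln (tau n))%:E)%E.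

Lemma t_star_level_exists m k : exists2 n, (k <= n)%N & t_star_level m n.
Proof.
have : (t_star < t_star + (m.+1%:R^-1)%:E)%E.
  rewrite lteDl ?lte_fin ?invr_gt0//.
  by rewrite ge0_fin_numE ?t_star_ge0// (le_lt_trans t_star_le)// ltry.
rewrite [X in (X < _)%E -> _]t_starE => /limn_einf_lt/(_ (maxn k m.+1))[n].
by rewrite geq_max => /andP[kn mn] nt; exists n.
Qed.

Lemma s_two_ge0 : (0 <= s_two)%E.
Proof.
rewrite leNgt; apply/negP; rewrite s_twoE => /limn_esup_lt[n0 /(_ n0.+1 (leqnSn _))].
rewrite lte_fin ltNge => /negP; apply.
rewrite log_ratio_ge ?prodN_gt0 ?tau_lt1//.
by rewrite oppr0 powRr0 prodN_ge1.
Qed.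

Lemma s_two_level_exists m k : exists2 n, (k <= n)%N & s_two_level m n.
Proof.
have : (s_two - (m.+1%:R^-1)%:E < s_two)%E.
  rewrite lteBlDr// lteDl ?lte_fin ?invr_gt0//.
  by rewrite ge0_fin_numE ?s_two_ge0// (le_lt_trans s_two_le)// ltry.
rewrite [X in (_ < X)%E -> _]s_twoE => /limn_esup_gt/(_ (maxn k m.+1))[n].
by rewrite geq_max => /andP[kn mn] nt; exists n.
Qed.

Lemma t_star_levelP s : (t_star < s%:E)%E -> exists m0, forall m n, (m0 <= m)%N ->
  t_star_level m n -> P n <= sigma n `^ (- s).
Proof.
have : t_star \is a fin_num.
  by rewrite ge0_fin_numE ?t_star_ge0// (le_lt_trans t_star_le)// ltry.
move=> /fineK tE; rewrite -tE lte_fin => ts.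
have st0 : 0 < s - fine t_star by rewrite subr_gt0.
(* From this [m] on, [1 / m.+1] is less than [s - t_star]. *)
exists (Num.truncn (s - fine t_star)^-1) => m n m0 [mn].
rewrite -tE -EFinD lte_fin => h.
rewrite -log_ratio_le ?prodN_gt0 ?sigma_lt1//; last exact: leq_ltn_trans mn.
apply/ltW/(lt_trans h); rewrite -ltrBrDl invf_plt ?posrE ?ltr0Sn//.
by apply: lt_le_trans (truncnS_gt _) _; rewrite ler_nat ltnS.
Qed.

Lemma s_two_levelP s : (s%:E < s_two)%E -> exists m0, forall m n, (m0 <= m)%N ->
  s_two_level m n -> tau n `^ (- s) <= P n.+1.
Proof.
have : s_two \is a fin_num.
  by rewrite ge0_fin_numE ?s_two_ge0// (le_lt_trans s_two_le)// ltry.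
move=> /fineK tE; rewrite -tE lte_fin => ts.
have st0 : 0 < fine s_two - s by rewrite subr_gt0.
exists (Num.truncn (fine s_two - s)^-1) => m n m0 [mn].
rewrite -tE -EFinB lte_fin => h.
rewrite -log_ratio_ge ?prodN_gt0 ?tau_lt1//; last exact: leq_ltn_trans mn.
apply/ltW/(lt_trans _ h).
rewrite ltrBrDl -ltrBrDr invf_plt ?posrE ?ltr0Sn//.
by apply: lt_le_trans (truncnS_gt _) _; rewrite ler_nat ltnS.
Qed.

(** [K] is the largest integer with [K ^ d <= N n.+1]. Hence [N n.+1 < K.+1 ^ d], so the block of
    side [K] completes within side [K.+1], and [K.+1 <= 2 * K] gives the last bound. The [minn] in
    the proof keeps the block inside its parent. *)
Lemma cluster_offsets n : exists S K, [/\ offsets M N n S, (0 < K)%N,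
  {subset box (d:=d) K <= S}, {subset S <= box K.+1} & (K ^ d <= N n.+1 <= (2 * K) ^ d)%N].
Proof.
have /andP[N0 NM] := N_bounds (ltn0Sn n).
have ex : exists K, (K ^ d <= N n.+1)%N by exists 1%N; rewrite exp1n.
have bd K : (K ^ d <= N n.+1)%N -> (K <= M n.+1)%N.
  by move=> /leq_trans/(_ NM); rewrite leq_exp2r.
case: (ex_maxnP ex bd) => K KN maxK.
have K0 : (0 < K)%N by apply: maxK; rewrite exp1n.
have NK : (N n.+1 < K.+1 ^ d)%N by rewrite ltnNge; apply/negP => /maxK; rewrite ltnn.
have N2K : (N n.+1 <= (2 * K) ^ d)%N.
  by apply: leq_trans (ltnW NK) _; rewrite leq_exp2r//; lia.
have subK a b : (a <= b)%N -> {subset box (d:=d) a <= box b}.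
  move=> ab q; rewrite !mem_box => /forallP qa; apply/forallP => l.
  exact: leq_trans ab.
have [|||S [oS KS SK]] := @offsets_exist d M N n (box K) (minn K.+1 (M n.+1)) (box_uniq K).
- by apply: subK; rewrite leq_min leqnSn bd.
- exact: geq_minr.
- by rewrite size_box KN/=; case: (leqP K.+1 (M n.+1)) => _ //; exact: ltnW.
exists S, K; rewrite KN N2K; split=> // q /SK.
by apply: subK; exact: geq_minl.
Qed.

(** [K] is the largest integer with [K ^ d <= N n.+1] and [2 * K <= M n.+1]; the second condition
    makes the step [g] at least 2, so that the regular positions do not touch. If the first
    condition stops [K], then [N n.+1 < K.+1 ^ d]; if the second does, then [M n.+1 < 2 * K.+1] and
    [N n.+1 <= M n.+1 ^ d]. The factor 4 serves both cases. *)
Lemma spread_offsets n : exists S K g, [/\ offsets M N n S,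
  [/\ (0 < K)%N, (2 <= g)%N & (g * K <= M n.+1 <= 2 * (g * K))%N],
  forall j : {ffun 'I_d -> nat}, j \in box K -> [ffun l => (g * j l)%N] \in S &
  (K ^ d <= N n.+1 <= (4 * K) ^ d)%N].
Proof.
have /andP[N0 NM] := N_bounds (ltn0Sn n).
have M2 := M_ge2 (ltn0Sn n).
have ex : exists K, (K ^ d <= N n.+1)%N && (2 * K <= M n.+1)%N.
  by exists 1%N; rewrite exp1n N0 muln1.
have bd K : (K ^ d <= N n.+1)%N && (2 * K <= M n.+1)%N -> (K <= M n.+1)%N.
  by move=> /andP[_]; lia.
case: (ex_maxnP ex bd) => K /andP[KN KM] maxK.
have K0 : (0 < K)%N by apply: maxK; rewrite exp1n N0 muln1.
have NK : (N n.+1 <= (4 * K) ^ d)%N.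
  have [h|/ltnW h] := leqP (K.+1 ^ d) (N n.+1).
    apply: leq_trans NM _; rewrite leq_exp2r//.
    have : ~~ (2 * K.+1 <= M n.+1)%N.
      by apply/negP => h'; have := maxK K.+1; rewrite h h' ltnn => /(_ isT).
    by rewrite -ltnNge; lia.
  by apply: leq_trans h _; rewrite leq_exp2r//; lia.
pose g := (M n.+1 %/ K)%N.
have g2 : (2 <= g)%N by rewrite leq_divRL.
have gK : (g * K <= M n.+1)%N by exact: leq_trunc_div.
have Mg : (M n.+1 <= 2 * (g * K))%N.
  have := ltn_ceil (M n.+1) K0; rewrite -/g mulSn => h.
  by apply: leq_trans (ltnW h) _; rewrite mul2n -addnn leq_add2r leq_pmull// ltnW.
pose A : seq {ffun 'I_d -> nat} := [seq [ffun l => (g * j l)%N] | j : {ffun 'I_d -> nat} <- box K].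
have uA : uniq A.
  rewrite map_inj_in_uniq ?box_uniq// => q q' _ _ /ffunP e; apply/ffunP => l.
  have := e l; rewrite !ffunE => /eqP; rewrite eqn_pmul2l; first by move=> /eqP.
  exact: ltnW.
have [|//||S [oS AS _]] := @offsets_exist d M N n A (M n.+1) uA.
- move=> _ /mapP[q qK ->]; rewrite mem_box in qK.
  rewrite mem_box; apply/forallP => l; rewrite ffunE.
  apply: leq_trans gK; rewrite ltn_pmul2l; first exact: (forallP qK l).
  exact: ltnW.
- by rewrite size_map size_box KN.
exists S, K, g; split=> //; last by rewrite KN.
  by split=> //; rewrite gK.
by move=> j jK; apply: AS; apply/mapP; exists j.
Qed.

End scales.

(** * Bounds for every set of Omega *)

Lemma sum_half_pow_le1 (R : realFieldType) (Y : seq nat) : uniq Y ->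
  \sum_(i <- Y) (2^-1 : R) ^+ i.+1 <= 1.
Proof.
move=> uY; pose B := (\max_(i <- Y) i).+1.
apply: (@le_trans _ _ (\sum_(i <- index_iota 0 B) (2^-1 : R) ^+ i.+1)).
  have s0 (i : nat) : true -> 0 <= (2^-1 : R) ^+ i.+1 by rewrite exprn_ge0// invr_ge0.
  rewrite [leRHS](bigID (mem Y))/= -[leLHS]addr0 lerD//; last exact: sumr_ge0.
  rewrite -[leRHS]big_filter le_eqVlt; apply/orP; left; apply/eqP/perm_big.
  apply: uniq_perm => //; first by rewrite filter_uniq// iota_uniq.
  move=> i; rewrite mem_filter mem_index_iota /= ltnS.
  by case: (boolP (i \in Y)) => //= iY; rewrite (@leq_bigmax_seq _ _ xpredT id).
under eq_bigr do rewrite exprS; rewrite -mulr_sumr.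
have h : 0 <= (2^-1 : R) < 1 by rewrite invr_ge0 ler0n invf_lt1 ?ltr1n.
have e : 1 - 2^-1 = 2^-1 :> R by lra.
apply: (@le_trans _ _ (2^-1 * (2^-1 ^+ 0 / (1 - 2^-1)))); last first.
  by rewrite expr0 e invrK mul1r mulVf// pnatr_eq0.
by rewrite ler_pM2l ?invr_gt0//; exact: sum_geometric_le.
Qed.

(** * Mass distribution by counting cubes *)

Section hausdorff_lower_bound.
Context {R : realType} {d : nat} {M N : nat -> nat}.
Hypothesis d_gt0 : (0 < d)%N.
Hypothesis M_ge2 : forall k, (1 <= k)%N -> (2 <= M k)%N.
Hypothesis N_bounds : forall k, (1 <= k)%N -> (1 <= N k <= M k ^ d)%N.
Local Notation W := {ffun 'I_d -> nat}.
Local Notation cube := (@cube R d M).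
Local Notation cube_meets := (@cube_meets R d M).
Local Notation sigma := (@sigma R d M N).
Variable T : nat -> seq W.
Hypothesis treeT : tree M N T.

Let N_gt0 k : (0 < k)%N -> (0 < N k)%N.
Proof. by move=> /N_bounds/andP[]. Qed.

(** If the [s]-measure vanished for some [s < t_star], there would be a cover with a tiny [s]-sum.
    Its members are slightly enlarged so that finitely many contain all cubes of some level;
    counting the cubes of a finer level that they meet then accounts for at most half of that
    level. *)
Lemma t_star_le_dimH : (t_star R d M N <= dimH (@tree_set R d M T))%E.
Proof.
apply: le_ereal_inf_tmp => _ [s [s0 Hs] <-]; rewrite leNgt; apply/negP => st.
have [t tE] : exists t, t_star R d M N = t%:E.
  exists (fine (t_star R d M N)); rewrite fineK// ge0_fin_numE ?t_star_ge0//.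
  by rewrite (le_lt_trans (t_star_le d_gt0 M_ge2 N_bounds))// ltry.
have td : t <= d%:R by rewrite -lee_fin -tE; exact: t_star_le.
rewrite tE lte_fin in st.
pose s' := (s + t) / 2.
have [s'0 ss' s't s'd] : [/\ 0 < s', s < s', s' < t & s' <= d%:R].
  by rewrite /s'; split; lra.
have [n0 Hn0] : exists n0, forall n, (n0 <= n)%N ->
    sigma n `^ (- s') <= (seq_prod N n)%:R :> R.
  by apply: t_star_gt => //; rewrite tE lte_fin.
(* [5 ^ d] is the constant of [count_meets_tree]; [3 ^ s'] comes from the enlarged diameters
   [rho]. *)
pose A : R := 5 ^+ d * 3 `^ s'.
have A0 : 0 < A by rewrite mulr_gt0 ?powR_gt0 ?exprn_gt0.
(* With a quarter, [rho i <= 3 * delta] stays below [mesh n0]. *)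
pose delta := mesh R M n0 / 4.
have mesh_n0 : 0 < mesh R M n0 by exact: mesh_gt0.
have mesh_n1 : mesh R M n0 <= 1 by exact: mesh_le1.
have delta0 : 0 < delta by rewrite divr_gt0.
(* Diameters and enlargements each contribute at most [eta], and [A * (eta + eta) = 1 / 2 < 1]. *)
pose eta := (4 * A)^-1.
have eta0 : 0 < eta by rewrite invr_gt0 mulr_gt0.
have /ereal_inf_lt[_ [I [U [Ud EU ->]]] sumU] :
    (hausdorff_premeasure s delta (@tree_set R d M T) < eta%:E)%E.
  apply: (@le_lt_trans _ _ 0%E); last by rewrite lte_fin.
  by rewrite -Hs; apply: ereal_sup_ubound; exists delta.
pose D i : R := fine (ediam (U i)).
have DE i : I i -> ediam (U i) = (D i)%:E.
  move=> Ii; rewrite fineK// ge0_fin_numE ?ediam_ge0//.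
  by rewrite (le_lt_trans (Ud _ Ii))// ltry.
have D0 i : I i -> 0 <= D i <= delta.
  by move=> Ii; rewrite -!lee_fin -DE// ediam_ge0 Ud.
(* A positive enlargement even when [U i] has diameter 0, with [s']-powers summing to at most
   [eta]. *)
pose kappa i := Num.min delta ((eta * 2^-1 ^+ i.+1) `^ s'^-1).
have kappa0 i : 0 < kappa i.
  by rewrite lt_min delta0 powR_gt0// mulr_gt0// exprn_gt0// invr_gt0.
have kappad i : kappa i <= delta by rewrite ge_min lexx.
have kappas i : kappa i `^ s' <= eta * 2^-1 ^+ i.+1.
  have e0 : 0 < eta * 2^-1 ^+ i.+1 by rewrite mulr_gt0// exprn_gt0// invr_gt0.
  have -> : eta * 2^-1 ^+ i.+1 = ((eta * 2^-1 ^+ i.+1) `^ s'^-1) `^ s'.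
    by rewrite -powRrM mulVf ?gt_eqF// powRr1// ltW.
  apply: ge0_ler_powR; rewrite ?nnegrE ?powR_ge0 ?(ltW s'0) ?(ltW (kappa0 i))//.
  by rewrite ge_min lexx orbT.
(* The enlarged set has diameter at most [D i + 2 * kappa i]. *)
pose rho i := 3 * Num.max (D i) (kappa i).
have max0 i : 0 < Num.max (D i) (kappa i) by rewrite lt_max kappa0 orbT.
have rho0 i : I i -> 0 < rho i < mesh R M n0.
  move=> Ii; rewrite mulr_gt0//=; have /andP[_ Dd] := D0 i Ii.
  have : Num.max (D i) (kappa i) <= delta by rewrite ge_max Dd kappad.
  by rewrite /rho /delta; move=> h; lra.
have rhos i : I i -> rho i `^ s' <= 3 `^ s' * (D i `^ s' + kappa i `^ s').
  move=> Ii; rewrite powRM ?(ltW (max0 i))// ler_pM2l ?powR_gt0//.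
  by case: (leP (D i) (kappa i)) => _; rewrite ?lerDl ?lerDr powR_ge0.
pose V i : set 'rV[R]_d := [set y | exists2 u, U i u & eudist u y < kappa i].
have Vrho i : I i -> forall x y, V i x -> V i y -> eudist x y <= rho i.
  move=> Ii x y [u Uu ux] [v Uv vy].
  have h1 := eudist_triangle x u y; have h2 := eudist_triangle u v y.
  have : ((eudist u v)%:E <= ediam (U i))%E by exact: eudist_le_ediam.
  rewrite DE// lee_fin => uv; rewrite eudist_sym in ux.
  have m1 : D i <= Num.max (D i) (kappa i) by rewrite le_max lexx.
  have m2 : kappa i <= Num.max (D i) (kappa i) by rewrite le_max lexx orbT.
  rewrite /rho; lra.
have /choice[k Hk] i : exists k, I i -> forall n U, (k <= n)%N ->
    (forall x y, U x -> U y -> eudist x y <= rho i) ->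
    (count (cube_meets n U) (T n))%:R <= 5 ^+ d * rho i `^ s' * (seq_prod N n)%:R.
  have [Ii|] := pselect (I i); last by exists 0%N.
  have s'0d : 0 <= s' <= d%:R by rewrite ltW.
  have [k Hk] := count_meets_tree d_gt0 M_ge2 N_gt0 treeT s'0d Hn0 (rho0 i Ii).
  by exists k.
have [n1 Hn1] : exists n, forall q, q \in T n -> exists2 i, I i & cube n q `<=` V i.
  apply: (@tree_compact R d M N M_ge2 T treeT
    (fun n q => exists2 i, I i & cube n q `<=` V i)).
    move=> n j q [i Ii qV]; exists i => //.
    by apply: subset_trans qV; exact: cube_ancestor.
  move=> x /EU[i Ii Uix].
  have sd : 0 < Num.sqrt d%:R :> R by rewrite sqrtr_gt0 ltr0n.
  have [n Hn] := mesh_small M_ge2 (divr_gt0 (kappa0 i) sd).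
  exists n => q qT xq; exists i => // y yq; exists x => //.
  have := Hn n (leqnn n); rewrite ltr_pdivlMr// mulrC; apply: le_lt_trans.
  by rewrite -lee_fin; apply: le_trans (eudist_le_ediam xq yq) _; exact: ediam_cube.
have /choice[f Hf] q : exists i, q \in T n1 -> I i /\ cube n1 q `<=` V i.
  have [/Hn1[i Ii qV]|_] := boolP (q \in T n1); first by exists i.
  by exists 0%N.
pose Y := undup [seq f q | q <- T n1].
have uY : uniq Y by exact: undup_uniq.
have YI i : i \in Y -> I i.
  by rewrite mem_undup => /mapP[q /Hf[Ii _] ->].
(* Fine enough for the finite cover and for the counting bounds of its finitely many members. *)
pose n := maxn n1 (\max_(i <- Y) k i).
have n1n : (n1 <= n)%N by exact: leq_maxl.
have kn i : i \in Y -> (k i <= n)%N.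
  move=> iY; apply: leq_trans (leq_maxr _ _).
  exact: (@leq_bigmax_seq _ _ xpredT k i iY).
have P0 : 0 < (seq_prod N n)%:R :> R by rewrite ltr0n seq_prod_gt0.
have le1 : (seq_prod N n)%:R <= \sum_(i <- Y) (count (cube_meets n (V i)) (T n))%:R :> R.
  rewrite -natr_sum ler_nat -(size_tree treeT n) -sum1_size.
  under [leqRHS]eq_bigr do rewrite -sum1_count big_mkcond/=.
  rewrite exchange_big/= big_seq [leqRHS]big_seq; apply: leq_sum => q qT.
  pose q1 := ancestor M n1 (n - n1) q.
  have q1T : q1 \in T n1 by apply: (ancestor_tree treeT); rewrite subnKC.
  have fY : f q1 \in Y by rewrite mem_undup map_f.
  rewrite (bigD1_seq (f q1))//= ifT ?leq_addr//.
  apply/cube_meetsP; exists (corner (M:=M) n q); last exact: cube_corner.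
  have [_] := Hf _ q1T; apply.
  apply: (cube_ancestor M_ge2 (j:=(n - n1)%N)); rewrite subnKC//.
  exact: cube_corner.
have le2 : \sum_(i <- Y) (count (cube_meets n (V i)) (T n))%:R <=
    A * (\sum_(i <- Y) D i `^ s' + \sum_(i <- Y) kappa i `^ s') * (seq_prod N n)%:R.
  rewrite -big_split/= mulr_sumr mulr_suml big_seq [leRHS]big_seq.
  apply: ler_sum => i iY.
  apply: le_trans (Hk i (YI i iY) n (V i) (kn i iY) (Vrho i (YI i iY))) _.
  rewrite ler_pM2r// /A -mulrA ler_pM2l ?exprn_gt0//.
  exact: rhos (YI i iY).
have le3 : \sum_(i <- Y) D i `^ s' <= eta.
  apply: (@le_trans _ _ (\sum_(i <- Y) D i `^ s)).
    rewrite big_seq [leRHS]big_seq; apply: ler_sum => i /YI/D0/andP[Di0 Did].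
    (* [ger_powR] needs a positive base. A zero diameter contributes 0 because [s' > 0], even if
       [s = 0]. *)
    have [->|Dn0] := eqVneq (D i) 0.
      by rewrite powR0 ?powR_ge0// gt_eqF.
    apply: ger_powR; last exact: ltW.
    rewrite lt_neqAle eq_sym Dn0 Di0/=; apply: le_trans Did _.
    rewrite /delta; lra.
  apply/ltW; rewrite -lte_fin; apply: le_lt_trans sumU.
  apply: esum_ge; exists [set` Y].
    by split; [exact: finite_seq|move=> i /YI].
  rewrite -fsbig_seq// -sumEFin big_seq [leRHS]big_seq.
  by apply: lee_sum => i /YI Ii; rewrite DE// poweR_EFin.
have le4 : \sum_(i <- Y) kappa i `^ s' <= eta.
  apply: (@le_trans _ _ (\sum_(i <- Y) eta * 2^-1 ^+ i.+1)).
    by apply: ler_sum.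
  by rewrite -mulr_sumr ler_piMr ?(ltW eta0)// sum_half_pow_le1.
have := le_trans le1 le2; rewrite -[X in X <= _ -> _]mul1r ler_pM2r// => h.
have : A * (\sum_(i <- Y) D i `^ s' + \sum_(i <- Y) kappa i `^ s') <= A * (eta + eta).
  by rewrite ler_pM2l// lerD.
have -> : A * (eta + eta) = 2^-1 by rewrite /eta; field; rewrite gt_eqF.
by move=> /(le_trans h); lra.
Qed.

End hausdorff_lower_bound.

Section covers_by_boxes.
Context {R : realType} {d : nat}.
Implicit Types (F : set 'rV[R]_d) (x : 'rV[R]_d) (b delta : R).

Lemma coverable_le n F delta delta' : delta <= delta' ->
  coverable n F delta -> coverable n F delta'.
Proof.
move=> le [U [Ud FU]]; exists U; split=> // i.
by apply: le_trans (Ud i) _; rewrite lee_fin.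
Qed.

Lemma subinterval_index (t b : R) m : 0 < b -> (0 < m)%N -> 0 <= t <= b ->
  exists2 o, (o < m)%N & o%:R * (b / m%:R) <= t <= o.+1%:R * (b / m%:R).
Proof.
move=> b0 m0 /andP[t0 tb].
have c0 : 0 < b / m%:R by rewrite divr_gt0// ltr0n.
rewrite -(divrK (unitf_gt0 c0) t); set v := t / (b / m%:R).
have v0 : 0 <= v by rewrite divr_ge0// ltW.
have vm : v <= m%:R.
  by rewrite ler_pdivrMr// mulrCA mulfV ?mulr1// pnatr_eq0 -lt0n.
have h1 : (Num.truncn v)%:R <= v by rewrite truncn_le.
have h2 := truncnS_gt v.
have [tm|mt] := ltnP (Num.truncn v) m.
  by exists (Num.truncn v) => //; rewrite !ler_pM2r// h1 ltW.
(* Only the right end [t = b] gets here; it is put in the last subinterval. *)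
exists m.-1; first by rewrite prednK.
rewrite !ler_pM2r// prednK// vm andbT.
by apply: le_trans h1; rewrite ler_nat (leq_trans _ mt)// leq_pred.
Qed.

Lemma coverable_boxes (I : eqType) (t : seq I) (a : I -> 'I_d -> R) F b m :
  0 < b -> (0 < m)%N ->
  (forall x, F x -> exists2 q, q \in t & forall l, a q l <= x 0 l <= a q l + b) ->
  coverable (size t * m ^ d) F (Num.sqrt d%:R * (b / m%:R)).
Proof.
move=> b0 m0 Ft.
have c0 : 0 < b / m%:R by rewrite divr_gt0// ltr0n.
pose U (qo : I * {ffun 'I_d -> nat}) : set 'rV[R]_d := [set x | forall l,
  a qo.1 l + (qo.2 l)%:R * (b / m%:R) <= x 0 l
  <= a qo.1 l + (qo.2 l).+1%:R * (b / m%:R)].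
rewrite -(size_box (d:=d) m) -(size_allpairs pair).
apply: (@coverable_seq _ _ _ _ U) => [qo _|x /Ft[q qt xq]].
  apply: ediam_le => [|x y xU yU]; first by rewrite mulr_ge0 ?sqrtr_ge0// ltW.
  apply: eudist_le => [|l]; first exact: ltW.
  have /andP[x1 x2] := xU l; have /andP[y1 y2] := yU l.
  rewrite -natr1 mulrDl mul1r in x2; rewrite -natr1 mulrDl mul1r in y2.
  by rewrite ler_norml; apply/andP; split; lra.
have /choice[w ho] l : exists o, (o < m)%N /\
    o%:R * (b / m%:R) <= x 0 l - a q l <= o.+1%:R * (b / m%:R).
  have [|o om ob] := @subinterval_index (x 0 l - a q l) b m b0 m0.
    by have /andP[? ?] := xq l; apply/andP; split; lra.
  by exists o.
exists (q, [ffun l => w l]).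
  apply/allpairsP; exists (q, [ffun l => w l]); split=> //=.
  by rewrite mem_box; apply/forallP => l; rewrite ffunE; have [] := ho l.
move=> l /=; rewrite ffunE; have [_ /andP[h1 h2]] := ho l.
by apply/andP; split; lra.
Qed.

End covers_by_boxes.

(** * Upper bounds for the box dimensions *)

Section box_dimension_bounds.
Context {R : realType} {d : nat} {M N : nat -> nat}.
Hypothesis d_gt0 : (0 < d)%N.
Hypothesis M_ge2 : forall k, (1 <= k)%N -> (2 <= M k)%N.
Hypothesis N_bounds : forall k, (1 <= k)%N -> (1 <= N k <= M k ^ d)%N.
Local Notation W := {ffun 'I_d -> nat}.
Local Notation cube := (@cube R d M).
Local Notation mesh := (mesh R M).
Local Notation sigma := (@sigma R d M N).
Local Notation tau := (@tau R d M N).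
Local Notation nu := (@nu R d N).
Local Notation t_star_level := (@t_star_level R d M N).
Local Notation P n := ((seq_prod N n)%:R : R).
Variable T : nat -> seq W.
Hypothesis treeT : tree M N T.
Local Notation E := (@tree_set R d M T).

Let N_gt0 k : (0 < k)%N -> (0 < N k)%N.
Proof. by move=> /N_bounds/andP[]. Qed.

Let mesh_gt0 n : 0 < mesh n. Proof. exact: mesh_gt0. Qed.

Lemma tree_set_neq0 : E !=set0.
Proof.
have [T0 _ _ _] := treeT.
have [|x xE _] := @tree_set_meets R d M N M_ge2 T 0%N root_index N_gt0 treeT.
  by rewrite T0 mem_head.
by exists x.
Qed.

Lemma coverable_tree_set n m : (0 < m)%N ->
  coverable (seq_prod N n * m ^ d) E (Num.sqrt d%:R * (mesh n / m%:R)).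
Proof.
move=> m0; rewrite -(size_tree treeT n).
apply: (coverable_boxes (a:=fun (q : W) l => (q l)%:R * mesh n)) => // x /(_ n)[q qT xq].
exists q => // l; have /andP[x1 x2] := xq l.
by rewrite x1 -[X in _ <= _ + X]mul1r -mulrDl natr1.
Qed.

(** The two covers change places at [r = tau k], where subdividing the cubes of level [k] costs
    [P k * (mesh k / tau k) ^ d = P k.+1] boxes. *)
Lemma coverable_s_two s n0 (r : R) : 0 <= s ->
  (forall n, (n0 <= n)%N -> P n.+1 <= tau n `^ (- s)) ->
  0 < r < mesh n0 ->
  exists2 n, coverable n E (Num.sqrt d%:R * r) & n%:R <= 2 ^+ d * r `^ (- s).
Proof.
move=> s0 Hs r_n0; have /andP[r0 _] := r_n0.
have [k [n0k kr rk]] := mesh_bracket M_ge2 r_n0.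
have d2 : 1 <= 2 ^+ d :> R by rewrite exprn_ege1// ler1n.
have t0 : 0 < tau k by exact: tau_gt0.
have [rt|tr] := leP r (tau k).
  exists (seq_prod N k.+1).
    apply: (@coverable_le _ _ _ _ (Num.sqrt d%:R * (mesh k.+1 / 1%:R))).
      by rewrite divr1 ler_wpM2l ?sqrtr_ge0.
    by rewrite -[X in coverable X]muln1 -[X in (_ * X)%N](exp1n d); exact: coverable_tree_set.
  apply: le_trans (Hs k n0k) _.
  apply: (@le_trans _ _ (r `^ (- s))); last by rewrite ler_peMl ?powR_ge0.
  rewrite !powRN lef_pV2 ?posrE ?powR_gt0//.
  by apply: ge0_ler_powR; rewrite ?nnegrE ?(ltW r0) ?(ltW t0).
pose m := (Num.truncn (mesh k / r)).+1.
have h1 : 1 <= mesh k / r by rewrite ler_pdivlMr// mul1r ltW.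
have h2 : (Num.truncn (mesh k / r))%:R <= mesh k / r.
  by rewrite truncn_le divr_ge0// ltW.
have mlow : mesh k / r < m%:R by exact: truncnS_gt.
have mup : m%:R <= 2 * (mesh k / r) by rewrite /m -(natr1 (Num.truncn _)); lra.
have m0 : 0 < m%:R :> R by rewrite ltr0n.
exists (seq_prod N k * m ^ d)%N.
  apply: coverable_le (coverable_tree_set k _) => //.
  rewrite ler_wpM2l ?sqrtr_ge0// ler_pdivrMr//.
  by rewrite mulrC -ler_pdivrMr// ltW.
rewrite natrM natrX.
apply: (@le_trans _ _ (P k * (2 * (mesh k / r)) ^+ d)).
  by rewrite ler_wpM2l ?ler0n// lerXn2r// nnegrE ?ler0n// mulr_ge0// divr_ge0// ltW.
rewrite exprMn mulrCA ler_pM2l ?exprn_gt0//.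
(* [s] may exceed [d], and then [(tau k / r) ^ d] is not bounded by [(tau k / r) ^ s]; the volume
   bound [P k * mesh k ^ d <= 1] is used instead. *)
have [sd|ds] := leP s d%:R.
  have -> : mesh k / r = tau k / r * nu k.
    have nu0 : 0 < nu k by exact: nu_gt0 N_bounds k.
    by rewrite /tau mulrAC mulfVK// gt_eqF.
  have nuk : nu k ^+ d = (N k.+1)%:R by exact: (nuX d_gt0 N_bounds).
  rewrite exprMn nuk mulrCA -natrM -seq_prodS mulrC.
  rewrite -(@powR_mulrn _ (tau k / r)) ?(divr_ge0 (ltW t0) (ltW r0))//.
  apply: (@le_trans _ _ (P k.+1 * (tau k / r) `^ s)).
    rewrite ler_wpM2l ?ler0n//; apply: ger_powR => //.
    by rewrite divr_gt0//= ler_pdivrMr// mul1r ltW.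
  rewrite (@powRM _ (tau k) r^-1) ?(ltW t0) ?invr_ge0 ?(ltW r0)//.
  have -> : r^-1 `^ s = r `^ (- s) by rewrite -powR_inv1 ?(ltW r0)// -powRrM mulN1r.
  rewrite mulrA ler_piMl ?powR_ge0// -ler_pdivlMr ?powR_gt0// mul1r -powRN.
  exact: Hs.
have Pk : P k * mesh k ^+ d <= 1.
  rewrite -ler_pdivlMr ?exprn_gt0// div1r -powR_mulrn ?(ltW (mesh_gt0 k))// -powRN.
  exact: prodN_le_mesh.
rewrite exprMn mulrA; apply: (@le_trans _ _ (1 * r^-1 ^+ d)).
  by rewrite ler_wpM2r// exprn_ge0// invr_ge0 ltW.
rewrite mul1r -powR_mulrn ?invr_ge0 ?(ltW r0)// -powR_inv1 ?(ltW r0)// -powRrM mulN1r.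
apply: ger_powR; last by rewrite lerN2 ltW.
by rewrite r0/= (le_trans (ltW rk))// mesh_le1.
Qed.

Lemma upper_dimB_le_s_two : (upper_dimB E <= s_two R d M N)%E.
Proof.
apply: lee_real_above => s ss.
have s2fin : s_two R d M N \is a fin_num.
  by rewrite ge0_fin_numE ?s_two_ge0// (le_lt_trans (s_two_le d_gt0 M_ge2 N_bounds))// ltry.
have [t tE] : exists t, s_two R d M N = t%:E.
  by exists (fine (s_two R d M N)); rewrite fineK.
have t0 : 0 <= t by rewrite -lee_fin -tE; exact: s_two_ge0.
rewrite tE lte_fin in ss.
pose s' := (s + t) / 2.
have [s'0 ts' s's] : [/\ 0 <= s', t < s' & s' < s] by rewrite /s'; split; lra.
have [n0 Hn0] : exists n0, forall n, (n0 <= n)%N -> P n.+1 <= tau n `^ (- s').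
  by apply: s_two_lt => //; rewrite tE lte_fin.
have sd : 0 < Num.sqrt d%:R :> R by rewrite sqrtr_gt0 ltr0n.
pose c : R := 2 ^+ d * Num.sqrt d%:R `^ s.
have c0 : 0 < c by rewrite mulr_gt0 ?exprn_gt0 ?powR_gt0.
have ss' : 0 < s - s' by rewrite subr_gt0.
have ci0 : 0 < c^-1 by rewrite invr_gt0.
(* Passing from [s'] to [s] gains a factor [r ^ (s - s')], which absorbs the constant [c] for small
   [r]. *)
have [b b0 Hb] := powR_small ss' ci0.
apply: (@upper_dimB_le _ _ _ _ (Num.sqrt d%:R * Num.min (mesh n0) b)).
  by rewrite mulr_gt0// lt_min mesh_gt0.
move=> delta /andP[delta0 hd]; pose r := delta / Num.sqrt d%:R.
have r0 : 0 < r by rewrite divr_gt0.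
have dE : delta = Num.sqrt d%:R * r by rewrite mulrCA mulfV ?mulr1// gt_eqF.
have : r < Num.min (mesh n0) b by rewrite ltr_pdivrMr// mulrC.
rewrite lt_min => /andP[rn0 rb]; clearbody r.
have [|n nE nr] := coverable_s_two s'0 Hn0 (r:=r); first by rewrite r0.
exists n; first by rewrite dE.
apply: le_trans nr _; rewrite dE powRM ?(ltW sd) ?(ltW r0)//.
have -> : r `^ (- s') = r `^ (s - s') * r `^ (- s).
  rewrite -powRD; last by apply/implyP => _; rewrite gt_eqF.
  by congr (_ `^ _); ring.
rewrite mulrA ler_pM2r ?powR_gt0// powRN -[leRHS]mul1r ler_pdivlMr ?powR_gt0//.
rewrite mulrAC -/c mulrC -ler_pdivlMr// mul1r ltW//.
exact: Hb.
Qed.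

(** At a clustered level the children of a cube fit in one box of side
    [K n * mesh n.+1 <= 2 * sigma n], so one box per cube of level [n] covers the set. *)
Lemma lower_dimB_cluster (S : nat -> seq W) (K : nat -> nat) :
  (forall n, {subset S n <= box (K n)}) -> (forall n, (K n)%:R <= 2 * nu n) ->
  (forall m, exists2 n, t_star_level m n & T n.+1 =i extend M n (T n) (S n)) ->
  (lower_dimB E <= t_star R d M N)%E.
Proof.
move=> SK KN HT; apply: lee_real_above => s ss.
have tfin : t_star R d M N \is a fin_num.
  by rewrite ge0_fin_numE ?t_star_ge0// (le_lt_trans (t_star_le d_gt0 M_ge2 N_bounds))// ltry.
have [t tE] : exists t, t_star R d M N = t%:E.
  by exists (fine (t_star R d M N)); rewrite fineK.
rewrite tE lte_fin in ss.
pose s' := (s + t) / 2.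
have [ts' s's] : t < s' /\ s' < s by rewrite /s'; split; lra.
have [m0 Hm0] : exists m0, forall m n, (m0 <= m)%N ->
    t_star_level m n -> P n <= sigma n `^ (- s').
  by apply: t_star_levelP => //; rewrite tE lte_fin.
apply: lower_dimB_le => e e0.
have sd : 0 < Num.sqrt d%:R :> R by rewrite sqrtr_gt0 ltr0n.
pose c : R := 2 * Num.sqrt d%:R.
have c0 : 0 < c by rewrite mulr_gt0.
have ss' : 0 < s - s' by rewrite subr_gt0.
(* For [sigma n < b] the gain [sigma n ^ (s - s')] is below [c ^ -s], which turns [sigma n ^ -s']
   into at most [(c * sigma n) ^ -s]. *)
have [b b0 Hb] := powR_small ss' (powR_gt0 (- s) c0).
have [n1 Hn1] : exists n0, forall n, (n0 <= n)%N ->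
    mesh n < Num.min b (Num.min (e / c) c^-1).
  by apply: mesh_small => //; rewrite !lt_min b0 divr_gt0//= invr_gt0.
have [n nlev TE] := HT (maxn m0 n1).
have n1n : (n1 <= n)%N.
  have [+ _] := nlev; rewrite gtn_max => /andP[_]; exact: ltnW.
have := le_lt_trans (sigma_le_mesh d_gt0 M_ge2 N_bounds n) (Hn1 n n1n).
rewrite !lt_min => /and3P[sb se s1].
have sig0 : 0 < sigma n by exact: sigma_gt0.
exists (c * sigma n), (seq_prod N n); split.
- by rewrite mulr_gt0.
- by rewrite mulrC -ltr_pdivlMr.
- by rewrite mulrC -ltr_pdivlMr// div1r.
- rewrite -(muln1 (seq_prod N n)) -(exp1n d) -(size_tree treeT n).
  have -> : c * sigma n = Num.sqrt d%:R * (2 * sigma n / 1%:R).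
    by rewrite divr1 /c mulrAC mulrC.
  apply: (coverable_boxes (a:=fun (q : W) l => (q l)%:R * mesh n)) => //.
    by rewrite mulr_gt0.
  move=> x /(_ n.+1)[q']; rewrite TE => /mem_extend[q [w [qT /SK wK ->]]] xq'.
  exists q => // l; have /andP[x1 x2] := xq' l.
  rewrite mem_box in wK; have wl := forallP wK l.
  rewrite !ffunE in x1 x2; rewrite (meshS M_ge2 n) mulrA -natrM mulnC.
  apply/andP; split.
    by apply: le_trans x1; rewrite ler_pM2r// ler_nat leq_addr.
  apply: (le_trans x2); rewrite /sigma mulrCA [_ * (2 * _)]mulrC -mulrDl ler_pM2r//.
  apply: (@le_trans _ _ ((M n.+1 * q l + K n)%:R)); first by rewrite ler_nat -addnS leq_add2l.
  by rewrite natrD lerD2l.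
- have {}nlev : P n <= sigma n `^ (- s') by apply: Hm0 nlev; rewrite leq_maxl.
  apply: (le_trans nlev); rewrite powRM ?(ltW c0) ?(ltW sig0)//.
  have -> : sigma n `^ (- s') = sigma n `^ (s - s') * sigma n `^ (- s).
    rewrite -powRD; last by apply/implyP => _; rewrite gt_eqF.
    by congr (_ `^ _); ring.
  by rewrite ler_pM2r ?powR_gt0// ltW// Hb.
Qed.

End box_dimension_bounds.

(** * Lower bounds for typical sets *)

Section packing_lower_bound.
Context {R : realType} {d : nat}.

Lemma packing_premeasure_at_ge (F : set 'rV[R]_d) s (r delta : R) (I : eqType)
    (X : seq I) (c : I -> 'rV[R]_d) : uniq X -> 0 < r <= delta ->
  (forall x, x \in X -> F (c x)) ->
  (forall x y, x \in X -> y \in X -> x != y -> 2 * r < eudist (c x) (c y)) ->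
  (((size X)%:R * (2 * r) `^ s)%:E <= packing_premeasure_at s delta F)%E.
Proof.
move=> uX rd cF sep.
case: X uX cF sep => [|x0 X0]; first by rewrite mul0r => _ _ _;
  apply: ereal_sup_ubound; exists set0, (fun=> 0), (fun=> 0);
  split=> //; rewrite esum_set0.
set X := x0 :: X0 => uX cF sep.
have XX i : (i < size X)%N -> nth x0 X i \in X by exact: mem_nth.
apply: ereal_sup_ubound; exists `I_(size X), (fun i => c (nth x0 X i)), (fun=> r).
split=> //.
- by move=> i /XX/cF.
- apply/trivIsetP => i j /= iX jX ij; apply/seteqP; split=> // y [yi yj].
  have := sep _ _ (XX _ iX) (XX _ jX); rewrite nth_uniq// => /(_ ij).
  have := eudist_triangle (c (nth x0 X i)) y (c (nth x0 X j)).
  have yi' : eudist (c (nth x0 X i)) y <= r := yi.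
  have yj' : eudist y (c (nth x0 X j)) <= r by rewrite eudist_sym; exact: yj.
  lra.
- rewrite esum_fset//; last by move=> i _; rewrite lee_fin powR_ge0.
  by rewrite -fsbig_ord sumEFin sumr_const card_ord [in LHS]mulr_natl.
Qed.

Lemma dimA_le (F : set 'rV[R]_d) : (0 < d)%N -> (dimA F <= d%:R%:E)%E.
Proof.
move=> d0; apply: ereal_inf_lbound; exists d%:R => //; split; first exact: ler0n.
have sd : 0 < Num.sqrt d%:R :> R by rewrite sqrtr_gt0 ltr0n.
pose A : R := 2 * Num.sqrt d%:R + 1.
have A0 : 0 < A by rewrite /A; lra.
exists (A ^+ d); first by rewrite exprn_gt0.
move=> r rho r0 rrho _; have rho0 : 0 < rho by exact: lt_trans rrho.
apply: ge_ereal_sup => _ [x Fx <-].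
pose v := 2 * rho * Num.sqrt d%:R / r.
have v0 : 0 <= v by rewrite divr_ge0 ?mulr_ge0 ?sqrtr_ge0// ltW.
pose m := (Num.truncn v).+1.
have h2 : (Num.truncn v)%:R <= v by rewrite truncn_le.
have mlow : v < m%:R by exact: truncnS_gt.
have m0 : 0 < m%:R :> R by rewrite ltr0n.
have rr : 1 <= rho / r by rewrite ler_pdivlMr// mul1r ltW.
have mup : m%:R <= A * (rho / r).
  rewrite /m -(natr1 (Num.truncn _)) /A mulrDl mul1r.
  have -> : 2 * Num.sqrt d%:R * (rho / r) = v by rewrite /v mulrA (mulrAC 2).
  lra.
have cov : coverable (size [:: tt] * m ^ d) (F `&` cball x rho) r.
  apply: coverable_le (coverable_boxes (a:=fun _ l => x 0 l - rho) (b:=2 * rho) _ _ _) => //.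
  - rewrite mulrA ler_pdivrMr//.
    have : 2 * rho * Num.sqrt d%:R < m%:R * r by rewrite -ltr_pdivrMr.
    lra.
  - by rewrite mulr_gt0.
  - move=> y [_ yx]; exists tt => // l.
    have := le_trans (coord_le_eudist x y l) yx.
    by rewrite ler_norml => /andP[h3 h4]; apply/andP; split; lra.
apply: le_trans (covering_number_le cov) _.
rewrite mul1n lee_fin powR_mulrn ?(le_trans ler01 rr)// -exprMn natrX.
by rewrite lerXn2r ?nnegrE ?ler0n// (le_trans _ mup)// ltW.
Qed.

End packing_lower_bound.

Section typical_lower_bounds.
Context {R : realType} {d : nat} {M N : nat -> nat}.
Hypothesis d_gt0 : (0 < d)%N.
Hypothesis M_ge2 : forall k, (1 <= k)%N -> (2 <= M k)%N.
Hypothesis N_bounds : forall k, (1 <= k)%N -> (1 <= N k <= M k ^ d)%N.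
Local Notation W := {ffun 'I_d -> nat}.
Local Notation cube := (@cube R d M).
Local Notation mesh := (mesh R M).
Local Notation tau := (@tau R d M N).
Local Notation nu := (@nu R d N).
Local Notation s_two_level := (@s_two_level R d M N).
Local Notation P n := ((seq_prod N n)%:R : R).
Variable T : nat -> seq W.
Hypothesis treeT : tree M N T.
Local Notation E := (@tree_set R d M T).

Let M_gt0 k : (0 < k)%N -> (0 < M k)%N.
Proof. by move=> k0; rewrite (leq_trans _ (M_ge2 k0)). Qed.

Let N_gt0 k : (0 < k)%N -> (0 < N k)%N.
Proof. by move=> /N_bounds/andP[]. Qed.

Let mesh_gt0 n : 0 < mesh n. Proof. exact: mesh_gt0. Qed.

Definition spread (n : nat) (S : seq W) (K g : nat) : Prop :=
  [/\ offsets M N n S, [/\ (0 < K)%N, (2 <= g)%N & (g * K <= M n.+1 <= 2 * (g * K))%N],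
  forall j : W, j \in box K -> [ffun l => (g * j l)%N] \in S &
  (K ^ d <= N n.+1 <= (4 * K) ^ d)%N].

(** The gap persists across different parents: the last regular offset is at most [g * (K - 1)],
    which leaves [g] positions before the end of the parent since [g * K <= M n.+1]. *)
Lemma spread_child_gap n S K g (p p' j j' : W) : spread n S K g ->
  j \in box K -> j' \in box K ->
  child M n p [ffun l => (g * j l)%N] != child M n p' [ffun l => (g * j' l)%N] ->
  exists l, (M n.+1 * p l + g * j l + g <= M n.+1 * p' l + g * j' l)%N \/
            (M n.+1 * p' l + g * j' l + g <= M n.+1 * p l + g * j l)%N.
Proof.
move=> [_ [K0 g2 /andP[gM _]] _ _]; rewrite !mem_box => /forallP jK /forallP jK' ne.
have [l nl] : exists l, (M n.+1 * p l + g * j l != M n.+1 * p' l + g * j' l)%N.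
  apply/existsP; rewrite -negb_forall; apply: contra ne => /forallP e.
  by apply/eqP/ffunP => l; rewrite !ffunE; exact/eqP.
exists l; move: (jK l) (jK' l) nl; move: (p l) (p' l) (j l) (j' l) => a a' b b' {jK jK' ne}.
have step x y z w : (x < y)%N -> (z < K)%N ->
    (M n.+1 * x + g * z + g <= M n.+1 * y + g * w)%N.
  move=> xy zK; rewrite -addnA -mulnSr.
  apply: (@leq_trans (M n.+1 * x + M n.+1)%N).
    by rewrite leq_add2l (leq_trans _ gM)// leq_mul2l zK orbT.
  by rewrite -mulnSr (leq_trans _ (leq_addr _ _))// leq_mul2l xy orbT.
have step2 x z w : (z < w)%N ->
    (M n.+1 * x + g * z + g <= M n.+1 * x + g * w)%N.
  by move=> zw; rewrite -addnA leq_add2l -mulnSr leq_mul2l zw orbT.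
move=> bK bK' nl; case: (ltngtP a a') nl => [aa|aa|->] nl.
- by left; exact: step.
- by right; exact: step.
- case: (ltngtP b b') nl => [bb|bb|->] nl; [left|right|by rewrite eqxx in nl];
    exact: step2.
Qed.

Lemma spread_separated n S K g (p p' j j' : W) (y y' : 'rV[R]_d) : spread n S K g ->
  j \in box K -> j' \in box K ->
  child M n p [ffun l => (g * j l)%N] != child M n p' [ffun l => (g * j' l)%N] ->
  cube n.+1 (child M n p [ffun l => (g * j l)%N]) y ->
  cube n.+1 (child M n p' [ffun l => (g * j' l)%N]) y' ->
  tau n / 4 <= eudist y y'.
Proof.
move=> spr jK jK' ne yq yq'.
have [_ [K0 g2 /andP[_ Mg]] _ /andP[KN _]] := spr.
have r0 := mesh_gt0 n.+1; set r := mesh n.+1 in r0.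
(* Closed cubes whose indices differ by [g] are [(g - 1) * r] apart. Here [g >= 2] gives
   [g - 1 >= g / 2], and [K <= nu n] gives [tau n <= 2 * g * r]. *)
have gap : tau n / 4 <= (g%:R - 1) * r.
  have Knu : K%:R <= nu n by exact: (nat_le_nu d_gt0 N_bounds KN).
  have K0' : 0 < K%:R :> R by rewrite ltr0n.
  have t2 : tau n <= 2 * g%:R * r.
    rewrite /tau ler_pdivrMr ?(nu_gt0 N_bounds)// (meshS M_ge2 n) -/r.
    apply: (@le_trans _ _ (2 * g%:R * r * K%:R)); last first.
      by rewrite ler_pM2l// !mulr_gt0// ltr0n (leq_trans _ g2).
    rewrite mulrAC ler_pM2r// -!natrM ler_nat -mulnA.
    exact: Mg.
  have g2' : 2 <= g%:R :> R by rewrite ler_nat.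
  have : 0 <= (g%:R - 2) * r by rewrite mulr_ge0 ?subr_ge0 ?(ltW r0).
  lra.
apply: (le_trans gap).
have [l hl] := spread_child_gap spr jK jK' ne.
apply: le_trans (coord_le_eudist y y' l).
have := yq l; have := yq' l; rewrite !ffunE.
set a := (M n.+1 * p l + g * j l)%N in hl *; set b := (M n.+1 * p' l + g * j' l)%N in hl *.
rewrite -/r -!(natr1 a) -!(natr1 b) => /andP[h1 h2] /andP[h3 h4].
case: hl => hl; rewrite -(ler_nat R) natrD -(ler_pM2r r0) mulrDl in hl.
  rewrite distrC; apply: le_trans (ler_norm _); lra.
apply: le_trans (ler_norm _); lra.
Qed.

(** If the packing measure vanished for some [s < s_two], a piece [F i] of premeasure below 1 would
    meet every cube of the tree below some [q]. At a spread level, one point of [F i] in each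
    regular subcube below [q] gives a packing whose sum is at least 1. *)
Lemma s_two_le_dimP (S : nat -> seq W) (K g : nat -> nat) :
  (forall n, spread n (S n) (K n) (g n)) ->
  (forall m, exists2 n, s_two_level m n & T n.+1 =i extend M n (T n) (S n)) ->
  (s_two R d M N <= dimP E)%E.
Proof.
move=> spr HT; apply: le_ereal_inf_tmp => _ [s [s0 Ps] <-].
rewrite leNgt; apply/negP => st.
have [t tE] : exists t, s_two R d M N = t%:E.
  exists (fine (s_two R d M N)); rewrite fineK// ge0_fin_numE ?s_two_ge0//.
  by rewrite (le_lt_trans (s_two_le d_gt0 M_ge2 N_bounds))// ltry.
rewrite tE lte_fin in st.
pose s' := (s + t) / 2.
have [ss' s't] : s < s' /\ s' < t by rewrite /s'; split; lra.
have [m0 Hm0] : exists m0, forall m n, (m0 <= m)%N ->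
    s_two_level m n -> tau n `^ (- s') <= P n.+1.
  by apply: s_two_levelP => //; rewrite tE lte_fin.
have /ereal_inf_lt[_ [F EF <-] sumF] : (packing_measure s E < 1%:E)%E.
  by rewrite Ps lte_fin.
have [i [k [q [qT Hq]]]] := tree_baire M_ge2 N_gt0 treeT EF.
have Fi1 : (packing_premeasure s (F i) < 1%:E)%E.
  apply: le_lt_trans sumF.
  apply: le_trans (nneseries_lim_ge i.+1 _); last first.
    by move=> j _ _; exact: packing_premeasure_ge0.
  rewrite big_nat_recr//= leeDr// sume_ge0// => j _.
  exact: packing_premeasure_ge0.
have /ereal_inf_lt[_ [delta /= delta0 <-] pre1] := Fi1.
have Pk0 : 0 < P k by rewrite ltr0n seq_prod_gt0.
(* [4 ^ d] is the loss from keeping only the regular positions, [P k] the loss from staying below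
   [q], and [8 ^ s] comes from balls of diameter [tau n / 8]. *)
pose c : R := (4 ^+ d * P k * 8 `^ s)^-1.
have c0 : 0 < c by rewrite invr_gt0 !mulr_gt0 ?exprn_gt0 ?powR_gt0.
have ds : 0 < s' - s by rewrite subr_gt0.
have [b b0 Hb] := powR_small ds c0.
have [n1 Hn1] : exists n0, forall n, (n0 <= n)%N -> mesh n < Num.min b delta.
  by apply: mesh_small => //; rewrite lt_min b0.
have [n nlev TE] := HT (maxn m0 (maxn n1 k)).
have [n1n kn] : (n1 <= n)%N /\ (k <= n)%N.
  have [+ _] := nlev; rewrite !gtn_max => /and3P[_ ? ?]; split; exact: ltnW.
have {nlev}tP : tau n `^ (- s') <= P n.+1 by apply: Hm0 nlev; rewrite leq_maxl.
have tau0 : 0 < tau n by exact: tau_gt0.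
have := le_lt_trans (tau_le_mesh d_gt0 M_ge2 N_bounds n) (Hn1 n n1n).
rewrite lt_min => /andP[taub taud].
have [[uS _ Sb] [K0 g2 gM] jS /andP[_ NK]] := spr n.
pose Tq := [seq p <- T n | ancestor M k (n - k) p == q].
pose f (pj : W * W) := child M n pj.1 [ffun l => (g n * pj.2 l)%N].
(* Only the regular positions are used: the offsets added to reach [N n.+1] may touch them. *)
pose X0 : seq (W * W) := [seq (p, j) | p <- Tq, j <- box (K n)].
pose X := [seq f pj | pj <- X0].
have [_ uT _ _] := treeT.
have X0P pj : pj \in X0 -> [/\ pj.1 \in T n, ancestor M k (n - k) pj.1 = q &
    pj.2 \in box (K n)].
  move=> /allpairsP[[p j] /= [pT jK e]]; rewrite e /=.
  by move: pT; rewrite mem_filter => /andP[/eqP].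
have finj : {in X0 &, injective f}.
  move=> [p j] [p' j'] /X0P[_ _ jK] /X0P[_ _ jK'] /= e.
  have [/= -> /ffunP ej] := child_inj M_gt0 (Sb _ (jS _ jK)) (Sb _ (jS _ jK')) e.
  congr pair; apply/ffunP => l; have := ej l; rewrite !ffunE => /eqP.
  by rewrite eqn_pmul2l; [move=> /eqP|exact: ltnW].
have uX : uniq X.
  rewrite map_inj_in_uniq// allpairs_uniq ?box_uniq ?filter_uniq//.
  by move=> [? ?] [? ?] _ _.
have XT x : x \in X -> x \in T n.+1 /\ ancestor M k (n.+1 - k) x = q.
  move=> /mapP[[p j] /X0P[/= pT pq jK] ->]; split.
    by rewrite TE; apply/allpairsP; exists (p, [ffun l => (g n * j l)%N]); rewrite jS.
  rewrite subSn//= subnKC// parent_child// Sb// jS//.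
have /choice[y Hy] x : exists y, x \in X -> F i y /\ cube n.+1 x y.
  have [xX|_] := boolP (x \in X); last by exists 0.
  have [xT xq] := XT x xX.
  have [|y Fy xy] := Hq (n.+1 - k)%N x _ xq.
    by rewrite subnKC// ltnW.
  by exists y => _; split=> //; rewrite subnKC// in xy; exact: ltnW.
(* The points are [tau n / 4] apart, so radius [tau n / 16] leaves the strict inequality that
   disjointness of closed balls needs. *)
have h : (((size X)%:R * (2 * (tau n / 16)) `^ s)%:E <=
    packing_premeasure_at s delta (F i))%E.
  apply: (@packing_premeasure_at_ge R d (F i) s (tau n / 16) delta _ X y) => //.
  - by rewrite divr_gt0//=; lra.
  - by move=> x /Hy[].
  - move=> _ _ /mapP[[p j] pjX ->] /mapP[[p' j'] pjX' ->] ne.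
    have [_ _ jK] := X0P _ pjX; have [_ _ jK'] := X0P _ pjX'.
    have [_ c1] := Hy _ (map_f f pjX); have [_ c2] := Hy _ (map_f f pjX').
    have := spread_separated (spr n) jK jK' ne c1 c2; lra.
have := le_lt_trans h pre1; rewrite lte_fin ltNge => /negP; apply.
have sizeX : P n.+1 <= 4 ^+ d * P k * (size X)%:R.
  rewrite -!natrX -!natrM ler_nat size_map size_allpairs size_box size_filter.
  have := count_descendants treeT k (n - k)%N (pred1 q).
  have -> : count (pred1 q) (T k) = 1%N by rewrite count_uniq_mem// qT.
  rewrite subnKC// mul1n seq_prodS => <-.
  set z := count _ _; rewrite -/z.
  apply: (@leq_trans (z * seq_prod N k * (4 * K n) ^ d)%N).
    by rewrite leq_mul2l NK orbT.
  by rewrite expnMn [(z * seq_prod N k)%N]mulnC mulnCA -!mulnA leqnn.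
have -> : 2 * (tau n / 16) = tau n / 8 by lra.
have e8 : 8^-1 `^ s = (8 `^ s)^-1 :> R by rewrite -powR_inv1// powRAC powR_inv1// powR_ge0.
rewrite powRM ?invr_ge0 ?(ltW tau0)// e8.
have := Hb _ tau0 taub; rewrite /c => hb.
have ts : tau n `^ (s' - s) * tau n `^ (- s') * tau n `^ s = 1.
  rewrite -!powRD; try by apply/implyP => _; rewrite gt_eqF.
  by rewrite (_ : _ + s = 0) ?powRr0//; ring.
pose D : R := 4 ^+ d * P k * 8 `^ s.
have D0 : 0 < D by rewrite !mulr_gt0 ?exprn_gt0 ?powR_gt0.
have hD : D * tau n `^ (s' - s) <= 1.
  by rewrite -ler_pdivlMl// mulr1 ltW.
have t1 : 0 < tau n `^ s by exact: powR_gt0.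
have e1 : 0 < (8 `^ s : R) by exact: powR_gt0.
have t2 : tau n `^ (- s') * tau n `^ s <= 4 ^+ d * P k * (size X)%:R * tau n `^ s.
  by rewrite ler_pM2r// (le_trans tP).
rewrite -(ler_pM2l D0) mulr1.
rewrite -(ler_pM2r (powR_gt0 (s' - s) tau0)).
apply: (le_trans hD).
have -> : D * ((size X)%:R * (tau n `^ s / 8 `^ s)) * tau n `^ (s' - s) =
    4 ^+ d * P k * (size X)%:R * tau n `^ s * tau n `^ (s' - s).
  by rewrite /D; field; rewrite gt_eqF.
apply: (@le_trans _ _ (tau n `^ (- s') * tau n `^ s * tau n `^ (s' - s))).
  by rewrite mulrC mulrA ts.
by rewrite ler_pM2r// powR_gt0.
Qed.

(** A ball of radius [sqrt d * K n * mesh n.+1] sees a full block of [K n ^ d] cubes, and a set of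
    diameter [mesh n.+1] meets at most [5 ^ d] of them. For [s < d], no bound
    [C * (sqrt d * K n) ^ s] on the covering number survives large [K n]. *)
Lemma d_le_dimA (S : nat -> seq W) (K : nat -> nat) :
  (forall n, [/\ (0 < K n)%N, {subset box (K n) <= S n},
    (K n ^ d <= N n.+1)%N & (N n.+1 <= (2 * K n) ^ d)%N]) ->
  (forall m, exists2 n, (m <= N n.+1)%N & T n.+1 =i extend M n (T n) (S n)) ->
  (d%:R%:E <= dimA E)%E.
Proof.
move=> HS HT; apply: le_ereal_inf_tmp => _ [s [s0 [C C0 HC]] <-].
rewrite lee_fin leNgt; apply/negP => sd.
have sqd : 0 < Num.sqrt d%:R :> R by rewrite sqrtr_gt0 ltr0n.
pose A : R := 5 ^+ d * (C * Num.sqrt d%:R `^ s).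
have A0 : 0 < A by rewrite !mulr_gt0 ?exprn_gt0 ?powR_gt0.
have ds : 0 < d%:R - s by rewrite subr_gt0.
have A1 : 0 < A^-1 by rewrite invr_gt0.
have [b b0 Hb] := powR_small ds A1.
(* [K n > B] yields [1 / K n < b], and also [K n >= 2], which makes [r < rho] strict. It follows
   from [(2 * B) ^ d < N n.+1 <= (2 * K n) ^ d]. *)
pose B := (Num.truncn b^-1).+2.
have [n Nn TE] := HT ((2 * B) ^ d).+1.
have [K0 KS KN NK] := HS n.
have BK : (B < K n)%N.
  have : ((2 * B) ^ d < (2 * K n) ^ d)%N by exact: leq_trans NK.
  by rewrite ltn_exp2r// ltn_pmul2l.
have K2 : (2 <= K n)%N by exact: leq_trans (ltnW BK).
have Kr0 : 0 < (K n)%:R :> R by rewrite ltr0n.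
have KM : (K n <= M n.+1)%N.
  have /andP[_ NM] := N_bounds (ltn0Sn n).
  by rewrite -(leq_exp2r _ _ d_gt0) (leq_trans KN).
have [_ uT _ _] := treeT.
have [q qT] : exists q, q \in T n.
  have : (0 < size (T n))%N by rewrite (size_tree treeT) seq_prod_gt0.
  by case: (T n) => // q; exists q; rewrite mem_head.
pose X := [seq child M n q j | j <- box (K n)].
have sub : {subset box (d:=d) (K n) <= box (M n.+1)}.
  move=> j; rewrite !mem_box => /forallP jK; apply/forallP => l.
  exact: leq_trans KM.
have uX : uniq X.
  rewrite map_inj_in_uniq ?box_uniq// => j j' /sub jM /sub jM' e.
  by have [] := child_inj M_gt0 jM jM' e.
have XT x : x \in X -> x \in T n.+1.
  move=> /mapP[j jK ->]; rewrite TE; apply/allpairsP; exists (q, j); split=> //.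
  exact: KS.
have /choice[y Hy] x : exists y, x \in X -> E y /\ cube n.+1 x y.
  have [xX|_] := boolP (x \in X); last by exists 0.
  by have [y Ey xy] := tree_set_meets (R:=R) M_ge2 N_gt0 treeT (XT x xX); exists y.
have x0X : child M n q root_index \in X.
  apply/mapP; exists root_index => //; rewrite mem_box; apply/forallP => l.
  by rewrite ffunE.
set x0 := child M n q root_index in x0X.
have r0 := mesh_gt0 n.+1; set r := mesh n.+1 in r0.
pose rho := Num.sqrt d%:R * ((K n)%:R * r).
have sqd1 : 1 <= Num.sqrt d%:R :> R.
  by rewrite -[X in X <= _]sqrtr1 ler_sqrt ?ler0n// ler1n.
have rrho : r < rho.
  apply: (@lt_le_trans _ _ (1 * (2 * r))); first by lra.
  rewrite ler_pM// ?mulr_ge0 ?(ltW r0)// ler_pM2r// ler_nat//.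
have rhod : rho <= Num.sqrt d%:R.
  rewrite ler_piMr ?sqrtr_ge0//; apply: le_trans (mesh_le1 M_ge2 n).
  by rewrite (meshS M_ge2 n) ler_pM2r// ler_nat.
have [Ey0 y0] := Hy _ x0X.
have near_y x : x \in X -> eudist (y x0) (y x) <= rho.
  move=> xX; have [_ yx] := Hy _ xX; apply: eudist_le => [|l].
    by rewrite mulr_ge0 ?ler0n// ltW.
  have /mapP[j jK xE] := xX; rewrite xE in yx *.
  have := yx l; have := y0 l; rewrite !ffunE addn0 -/r.
  rewrite mem_box in jK; have jl := forallP jK l.
  have j1 : (M n.+1 * q l + j l).+1%:R * r <= ((M n.+1 * q l)%:R + (K n)%:R) * r.
    by rewrite ler_pM2r// -natrD ler_nat -addnS leq_add2l.
  have j2 : (M n.+1 * q l)%:R * r <= (M n.+1 * q l + j l)%:R * r.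
    by rewrite ler_pM2r// ler_nat leq_addr.
  have j3 : (M n.+1 * q l).+1%:R * r <= ((M n.+1 * q l)%:R + (K n)%:R) * r.
    by rewrite ler_pM2r// -natrD ler_nat -addn1 leq_add2l.
  rewrite mulrDl in j1 j3 => /andP[h1 h2] /andP[h3 h4].
  by rewrite ler_norml; apply/andP; split; lra.
have low : (((K n)%:R ^+ d / 5 ^+ d)%:E <= covering_number (E `&` cball (y x0) rho) r)%E.
  apply: covering_number_ge => m [U [Ur EU]].
  rewrite ler_pdivrMr ?exprn_gt0// -natrX -(size_box (d:=d)) -(size_map (child M n q)) -/X.
  apply: (@le_trans _ _ (\sum_(i < m) (count (cube_meets (R:=R) (M:=M) n.+1 (U i)) X)%:R)).
    rewrite -natr_sum ler_nat -sum1_size.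
    under [leqRHS]eq_bigr do rewrite -sum1_count big_mkcond/=.
    rewrite exchange_big/= big_seq [leqRHS]big_seq; apply: leq_sum => x xX.
    have [Ex yx] := Hy _ xX.
    have [|i _ Ui] := EU (y x).
      by split=> //; exact: near_y.
    rewrite (bigD1 i)//= ifT ?leq_addr//.
    by apply/cube_meetsP; exists (y x).
  rewrite -[m in leRHS]card_ord -[in leRHS]sumr_const mulr_suml; apply: ler_sum => i _.
  rewrite mul1r.
  have := @count_meets R d M M_ge2 n.+1 (U i) X r uX.
  rewrite mulfK ?gt_eqF//; apply=> // u v Uu Uv.
  by rewrite -lee_fin; apply: le_trans (Ur i); exact: eudist_le_ediam.
have := HC r rho r0 rrho rhod.
move=> /(le_trans (ereal_sup_ubound _)) => /(_ (covering_number (E `&` cball (y x0) rho) r)).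
have ex : exists2 x, E x & covering_number (E `&` cball x rho) r =
    covering_number (E `&` cball (y x0) rho) r by exists (y x0).
move=> /(_ ex)/(le_trans low); rewrite lee_fin.
have -> : rho / r = Num.sqrt d%:R * (K n)%:R by rewrite /rho mulrA mulfK ?gt_eqF.
rewrite powRM ?sqrtr_ge0 ?ler0n// ler_pdivrMr ?exprn_gt0//.
have -> : C * (Num.sqrt d%:R `^ s * (K n)%:R `^ s) * 5 ^+ d = A * (K n)%:R `^ s.
  by rewrite /A; ring.
rewrite leNgt => /negP; apply.
have Kb : (K n)%:R^-1 < b.
  rewrite invf_plt ?posrE//; apply: lt_trans (truncnS_gt _) _.
  by rewrite ltr_nat; exact: ltnW.
have := Hb _ _ Kb; rewrite invr_gt0 => /(_ Kr0).
have -> : (K n)%:R^-1 `^ (d%:R - s) = (K n)%:R `^ s / (K n)%:R ^+ d :> R.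
  rewrite -(@powR_inv1 _ (K n)%:R) ?ler0n// -powRrM mulN1r opprB powRD.
    by rewrite powRN powR_mulrn ?ler0n.
  by apply/implyP => _; rewrite gt_eqF.
rewrite ltr_pdivrMr ?exprn_gt0//.
by rewrite mulrC ltr_pdivlMr// mulrC.
Qed.

End typical_lower_bounds.

(** * The dimensions of a typical set *)

Lemma typicalS (T : topologicalType) (A B : set T) :
  A `<=` B -> typical A -> typical B.
Proof.
move=> AB [F nF AF]; apply: (@first_category_subset _ _ F nF).
by rewrite -AF; exact: subsetC.
Qed.

Theorem theorem1p3 (R : realType) (d : nat) (M N : nat -> nat)
    (d_ge1 : (1 <= d)%N)
    (M_ge2 : forall k, (1 <= k)%N -> (2 <= M k)%N)
    (N_bounds : forall k, (1 <= k)%N -> (1 <= N k <= M k ^ d)%N) :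
  [/\ typical [set E : Omega R d M N |
        dimH (cantor_set_of E) = t_star R d M N /\
        lower_dimB (cantor_set_of E) = t_star R d M N],
      typical [set E : Omega R d M N |
        dimP (cantor_set_of E) = s_two R d M N /\
        upper_dimB (cantor_set_of E) = s_two R d M N] &
      (~ exists B : nat, forall k, (1 <= k)%N -> (N k <= B)%N) ->
        typical [set E : Omega R d M N |
          dimA (cantor_set_of E) = d%:R%:E]].
Proof.
have /choice[S HS] := cluster_offsets d_ge1 N_bounds.
have /choice[K HK] := HS.
have oS n : offsets M N n (S n) by case: (HK n).
have treeE (E : Omega R d M N) := is_cantor_setP M_ge2 (svalP E).
split.
- apply: typicalS (typical_offsets d_ge1 M_ge2 N_bounds oS
    (t_star_level_exists (R:=R) d_ge1 M_ge2 N_bounds)) => E /= HE.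
  have [T tT ET] := treeE E; rewrite /cantor_set_of ET.
  have T0 : @tree_set R d M T !=set0 by exact: (tree_set_neq0 M_ge2 N_bounds tT).
  have lt := t_star_le_dimH (R:=R) d_ge1 M_ge2 N_bounds tT.
  have hl := dimH_le_lower_dimB T0.
  have lu : (lower_dimB (@tree_set R d M T) <= t_star R d M N)%E.
    apply: (lower_dimB_cluster d_ge1 M_ge2 N_bounds tT (S:=S) (K:=fun n => (K n).+1)).
    - by move=> n; case: (HK n).
    (* The block has side [(K n).+1], at most [2 * K n] as [K n >= 1]. *)
    - move=> n; have [_ K0 _ _ /andP[KN _]] := HK n.
      apply: (@le_trans _ _ (2 * (K n)%:R)).
        by rewrite -natrM ler_nat mul2n -addnn -addn1 leq_add2l.
      by rewrite ler_pM2l//; exact: (nat_le_nu d_ge1 N_bounds).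
    - exact: HE.
  by split; apply/eqP; rewrite eq_le ?lu ?lt ?(le_trans hl lu) ?(le_trans lt hl).
- have /choice[S' HS'] := spread_offsets d_ge1 M_ge2 N_bounds.
  have /choice[K' HK'] := HS'; have /choice[g Hg] := HK'.
  have oS' n : offsets M N n (S' n) by case: (Hg n).
  apply: typicalS (typical_offsets d_ge1 M_ge2 N_bounds oS'
    (s_two_level_exists (R:=R) d_ge1 M_ge2 N_bounds)) => E /= HE.
  have [T tT ET] := treeE E; rewrite /cantor_set_of ET.
  have T0 : @tree_set R d M T !=set0 by exact: (tree_set_neq0 M_ge2 N_bounds tT).
  have us := upper_dimB_le_s_two (R:=R) d_ge1 M_ge2 N_bounds tT.
  have pu := dimP_le_upper_dimB T0.
  have sp : (s_two R d M N <= dimP (@tree_set R d M T))%E.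
    by apply: (s_two_le_dimP d_ge1 M_ge2 N_bounds tT Hg); exact: HE.
  by split; apply/eqP; rewrite eq_le ?us ?sp ?(le_trans pu us) ?(le_trans sp pu).
- move=> Nunb.
  (* Large values of [N] occur arbitrarily late, since the first [k] terms are bounded by their
     maximum. *)
  have lev m k : exists2 n, (k <= n)%N & (m <= N n.+1)%N.
    apply: contrapT => /forall2NP H; apply: Nunb.
    exists (m + \max_(i < k.+1) N i)%N => i i1.
    have [ik|ki] := leqP i k.
      rewrite (leq_trans _ (leq_addl _ _))//.
      exact: (@leq_bigmax_cond _ xpredT (fun j : 'I_k.+1 => N j) (Ordinal (ik : (i < k.+1)%N))).
    have [|/negP] := H i.-1; first by rewrite -ltnS prednK// => /negP; rewrite -leqNgt leqNgt ki.
    by rewrite prednK// -ltnNge => /ltnW/leq_trans; apply; exact: leq_addr.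
  apply: typicalS (typical_offsets d_ge1 M_ge2 N_bounds oS lev) => E /= HE.
  have [T tT ET] := treeE E; rewrite /cantor_set_of ET.
  apply/eqP; rewrite eq_le dimA_le//=.
  apply: (d_le_dimA d_ge1 M_ge2 N_bounds tT (S:=S) (K:=K)); last exact: HE.
  by move=> n; have [_ K0 KS _ /andP[h1 h2]] := HK n.
Qed.
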